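(* In the Poisson multigraph model on $[n]$, $n\ge2$, let $W_k=\sum_{i=1}^k w(T_i)$ be the total cost of the first $k$ spanning trees. Then for every $k\ge1$, $$k^2\,\frac{n-1}{n}\le\mathbb E\,W_k\le k(k+1)\,\frac{n-1}{n}<k^2+k.$$
   Context: Poisson multigraph model: for each unordered pair $\{i,j\}$ of distinct vertices of $[n]$ there are infinitely many parallel edges whose costs are the points of an intensity-1 Poisson process on $(0,\infty)$, independent over pairs. $T_1$ is the minimum-cost spanning tree; for $k\ge2$, $T_k$ is the minimum-cost spanning tree of the multigraph with the edges of $T_1,\dots,T_{k-1}$ deleted. $w(T)$ is the total cost of the edges of $T$. *)

(* Defs.v *)
From HB Require Import structures.
From mathcomp Require Import all_boot all_order all_algebra finmap.
From mathcomp Require Import all_classical all_reals all_analysis.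
From mathcomp Require Import exponential_distribution.
Set Implicit Arguments. Unset Strict Implicit. Unset Printing Implicit Defensive.
Import Order.TTheory GRing.Theory Num.Theory.
Local Open Scope classical_set_scope.
Local Open Scope ring_scope.

(* Unordered pairs {i,j} of distinct vertices of [n] = 'I_n, represented as i < j. *)
Definition vpair (n : nat) := {p : 'I_n * 'I_n | (p.1 < p.2)%N}.

(* Edges of the multigraph: the m-th (0-indexed) parallel edge of pair p. *)
Definition medge (n : nat) := (vpair n * nat)%type.

Definition adj (n : nat) (F : {fset medge n}) : rel 'I_n :=
  fun u v => has (fun e : medge n =>
     (((val e.1).1 == u) && ((val e.1).2 == v)) ||
     (((val e.1).1 == v) && ((val e.1).2 == u))) (enum_fset F).

Definition is_spanning_tree (n : nat) (F : {fset medge n}) : bool :=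
  (#|` F| == n.-1)%N && [forall u : 'I_n, forall v : 'I_n, connect (adj F) u v].

Definition weight {R : realType} (n : nat) (c : medge n -> R)
    (F : {fset medge n}) : R :=
  \sum_(e <- enum_fset F) c e.

Definition is_MST {R : realType} (n : nat) (c : medge n -> R)
    (A : medge n -> Prop) (F : {fset medge n}) : Prop :=
  is_spanning_tree F /\ (forall e, e \in F -> A e) /\
  forall G : {fset medge n}, is_spanning_tree G -> (forall e, e \in G -> A e) ->
    weight c F <= weight c G.

(* T 0, T 1, ... are T_1, T_2, ...: T i is an MST of the multigraph with the
   edges of T 0, ..., T (i-1) deleted. *)
Definition greedy_MSTs {R : realType} (n : nat) (c : medge n -> R)
    (T : nat -> {fset medge n}) : Prop :=
  forall i : nat, is_MST c (fun e => forall j, (j < i)%N -> e \notin T j) (T i).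

(* Cost of the m-th parallel edge of pair p: the m-th point of the Poisson
   process built from the interarrival times X (p, 0), X (p, 1), ... *)
Definition cost {R : realType} {T : Type} (n : nat) (X : medge n -> T -> R)
    (w : T) : medge n -> R :=
  fun e => \sum_(l < e.2.+1) X (e.1, nat_of_ord l) w.

Definition mutually_independent {R : realType} {d} {Ω : measurableType d}
    {I : choiceType} (P : probability Ω R) (X : I -> Ω -> R) : Prop :=
  forall (J : {fset I}) (B : I -> set R),
    (forall i, i \in J -> measurable (B i)) ->
    P (\bigcap_(i in [set` J]) (X i @^-1` B i)) =
    (\prod_(i <- enum_fset J) P (X i @^-1` B i))%E.

(* Main.v *)
Require Import Defs.
From HB Require Import structures.
From mathcomp Require Import all_boot all_order all_algebra finmap.
From mathcomp Require Import all_classical all_reals all_analysis.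
From mathcomp Require Import exponential_distribution measurable_realfun.
From mathcomp Require Import ring lra zify.

(** Off a null set costs are distinct, so an edge belongs to none of the first [K]
trees exactly when its ends are joined by cheaper edges outside the first [K - 1]
trees.

Fix a pair [p] and [l < K].  Let [b] be the time, counted from the arrival of the
[l]-th edge of [p], until the ends of [p] get joined in the multigraph without the
first [K - 1] trees, where later edges of [p] are discarded.  Then [b] is independent
of the next interarrival time [X], that edge is accepted iff [X <= b], and
[E (min (b^+) X) = P (X <= b)] as [X] is exponential.  Summing over [l] and [p], the
expected total of [min (b^+) X] is the expected number [K (n - 1)] of accepted edges.
For fixed [p] these terms telescope to at least the time at which the ends of [p] get
joined, and comparing each edge of [T_K] with the [n] pairs formed by a root and the
end of the edge farther from it gives [n w(T_K) <= 2 sum_p sum_l min (b^+) X].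

For the lower bound, [W_k >= k (n - 1) t - sum_e (t - c e)^+] for every [t], the sum
being over the first [k] edges of every pair.  By the same identity the expected number
of points of a pair in [[0, s]] is at most [s], so [E sum_e (t - c e)^+] is at most
[n (n - 1) t^2 / 4].  Take [t = 2 k / n]. *)

Set Implicit Arguments.
Unset Strict Implicit.
Unset Printing Implicit Defensive.
Import Order.TTheory GRing.Theory Num.Theory.
Local Open Scope classical_set_scope.
Local Open Scope fset_scope.
Local Open Scope ring_scope.

Notation linked F u v := (connect (adj F) u v).
Notation fst_end e := (val e.1).1.
Notation snd_end e := (val e.1).2.

(** * Connectivity and spanning trees in finite edge sets *)

Section Connectivity.
Variable n : nat.
Implicit Types (F G T : {fset medge n}) (e f : medge n) (u v w r : 'I_n).

Lemma adjP F u v :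
  reflect (exists2 e, e \in F & val e.1 = (u, v) \/ val e.1 = (v, u))
          (adj F u v).
Proof.
apply: (iffP hasP) => -[e eF He]; exists e => //.
  by case/orP: He => /andP[/eqP <- /eqP <-]; [left|right]; rewrite -surjective_pairing.
by case: He => ->; rewrite /= !eqxx ?orbT.
Qed.

Lemma adj_sym F : symmetric (adj F).
Proof. by move=> u v; apply/adjP/adjP => -[e eF []]; exists e; auto. Qed.

Lemma linked_sym F u v : linked F u v = linked F v u.
Proof. exact: (sym_connect_sym (@adj_sym F)). Qed.

Lemma linked_edge F e : e \in F -> linked F (fst_end e) (snd_end e).
Proof.
move=> eF; apply/connect1/adjP; exists e => //.
by left; rewrite -surjective_pairing.
Qed.

Lemma linked_closure F G u v :
  (forall f, f \in F -> linked G (fst_end f) (snd_end f)) ->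
  linked F u v -> linked G u v.
Proof.
move=> FG; apply: connect_sub => x y /adjP[f /FG fG []] fe.
  by rewrite fe in fG.
by rewrite linked_sym; rewrite fe in fG.
Qed.

Lemma linked_sub F G u v : {subset F <= G} -> linked F u v -> linked G u v.
Proof. by move=> FG; apply: linked_closure => f /FG; apply: linked_edge. Qed.

Lemma unlinked_edge F G u v : linked F u v -> ~~ linked G u v ->
  exists2 f, f \in F & ~~ linked G (fst_end f) (snd_end f).
Proof.
move=> Fuv /negP Guv; apply: contrapT => noF; apply: Guv.
apply: linked_closure Fuv => f fF; apply: contrapT => /negP fG.
by apply: noF; exists f.
Qed.

(** Induction on the path: if its rest crosses [e] again, an earlier crossing of [e] can be cut out,
    so at most one crossing, in either direction, remains. *)
Lemma linked_add F e u v : linked (e |` F) u v ->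
  [\/ linked F u v,
      linked F u (fst_end e) /\ linked F (snd_end e) v
    | linked F u (snd_end e) /\ linked F (fst_end e) v].
Proof.
case/connectP => s; elim: s u => [|x s IH] u /=; first by move=> _ ->; constructor 1.
case/andP => /adjP[f] fF fe ps lv.
have {}IH := IH x ps lv.
have [fe0|nfe] := eqVneq f e.
  subst f.
  case: fe => fe; rewrite !fe /= in IH *; case: IH => /=.
  - by move=> ?; constructor 2.
  - by case=> _ ?; constructor 2.
  - by case=> _ ?; constructor 1.
  - by move=> ?; constructor 3.
  - by case=> _ ?; constructor 1.
  - by case=> _ ?; constructor 3.
have fF' : f \in F by move: fF; rewrite in_fset1U (negbTE nfe).
have ux : linked F u x.
  by apply/connect1/adjP; exists f.
case: IH.
- by move/(connect_trans ux) => ?; constructor 1.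
- by case=> /(connect_trans ux) ? ?; constructor 2.
- by case=> /(connect_trans ux) ? ?; constructor 3.
Qed.

(** Exchange property of cycles: [f] helps to join [u] and [v] only if its ends are [F]-linked one
    to [u] and the other to [v], and these two are joined with the help of [e]. *)
Lemma linked_exchange F e f u v :
  linked (e |` F) u v -> ~~ linked F u v ->
  linked (f |` F) u v -> linked (e |` F) (fst_end f) (snd_end f).
Proof.
move=> euv nF fuv.
have sub x y : linked F x y -> linked (e |` F) x y.
  by apply: linked_sub => z; rewrite in_fset1U => ->; rewrite orbT.
case: (linked_add fuv) => [h|[h1 h2]|[h1 h2]]; first by rewrite h in nF.
- have := connect_trans (connect_trans _ euv) _.
  by apply; [rewrite linked_sym; apply: sub|rewrite linked_sym; apply: sub].
- rewrite linked_sym.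
  have := connect_trans (connect_trans _ euv) _.
  by apply; [rewrite linked_sym; apply: sub|rewrite linked_sym; apply: sub].
Qed.

(** [S] picks vertices in distinct components of [F]. Adding an edge merges at most two components
    and thus costs at most one vertex of [S]. *)
Lemma unlinked_set F : exists S : {set 'I_n},
  (n <= #|S| + #|` F|)%N /\
  {in S &, forall u v, linked F u v -> u = v}.
Proof.
elim/finSet_rect: F => F IH.
have [->|[e eF]] := fset_0Vmem F.
  exists [set: 'I_n]%SET; rewrite cardsT card_ord leq_addr; split=> // u v _ _.
  by case/connectP => -[_ ->//|x s /=].
have [S [nS HS]] := IH _ (fproperD1 eF).
have FE : F = e |` (F `\ e) by rewrite fsetD1K.
have cF : #|` F| = (#|` F `\ e|).+1 by rewrite (cardfsD1 e F) eF.
have [/existsP[x /andP[xS xa]]|/existsPn nox] :=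
    boolP [exists x : 'I_n, (x \in S) && linked (F `\ e) x (fst_end e)].
  exists (S :\ x)%SET; split.
    by move: nS; rewrite cF (cardsD1 x S) xS add1n addSnnS.
  move=> u v; rewrite !inE => /andP[ux uS] /andP[vx vS].
  rewrite {1}FE => /linked_add[/HS|[ua _]|[_ av]]; first exact.
    by case/eqP: ux; apply: HS => //; apply: connect_trans ua _; rewrite linked_sym.
  by case/eqP: vx; apply/esym/HS => //; apply: connect_trans av.
exists S; split; first by rewrite cF addnS ltnW.
move=> u v uS vS; rewrite {1}FE => /linked_add[/HS|[ua _]|[_ av]]; first exact.
  by have := nox u; rewrite uS ua.
by have := nox v; rewrite vS linked_sym av.
Qed.

Lemma card_connected F : (forall u v, linked F u v) -> (n.-1 <= #|` F|)%N.
Proof.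
move=> FC; have [S [nS HS]] := unlinked_set F.
suff : (#|S| <= 1)%N by lia.
by apply/card_le1_eqP => u v uS vS; apply: HS.
Qed.

Lemma tree_linked T u v : is_spanning_tree T -> linked T u v.
Proof. by case/andP => _ /forallP/(_ u)/forallP/(_ v). Qed.

Lemma tree_unlinked T e : is_spanning_tree T -> e \in T ->
  ~~ linked (T `\ e) (fst_end e) (snd_end e).
Proof.
move=> tT eT; apply/negP => le.
have conn u v : linked (T `\ e) u v.
  apply: linked_closure (tree_linked u v tT) => f fT.
  have [->//|fe] := eqVneq f e.
  by apply: linked_edge; rewrite !inE fe.
have := card_connected conn; case/andP: tT => /eqP + _.
by rewrite (cardfsD1 e T) eT add1n => <-; rewrite ltnn.
Qed.

Lemma tree_swap T e f : is_spanning_tree T -> e \in T ->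
  ~~ linked (T `\ e) (fst_end f) (snd_end f) ->
  is_spanning_tree (f |` (T `\ e)).
Proof.
move=> tT eT nf.
have fT : f \notin T `\ e by apply: contra nf; apply: linked_edge.
apply/andP; split.
  rewrite cardfsU1 fT; case/andP: tT => /eqP <- _.
  by rewrite (cardfsD1 e T) eT.
have ef : linked (f |` (T `\ e)) (fst_end e) (snd_end e).
  apply: (@linked_exchange (T `\ e) f e (fst_end f) (snd_end f)) => //.
  - by apply: linked_edge; rewrite in_fset1U eqxx.
  - by rewrite fsetD1K //; apply: tree_linked.
apply/forallP => u; apply/forallP => v.
apply: linked_closure (tree_linked u v tT) => g gT.
have [->//|ge] := eqVneq g e.
by apply: linked_edge; rewrite in_fset1U in_fsetD1 ge gT orbT.
Qed.

(** Edges of [T] are added to [F] one at a time until the ends of [e] get linked. The edge [f] that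
    achieves this lies on the tree path between them: otherwise, by exchange, [T] without [f] would
    still link the ends of [f]. *)
Lemma tree_exchange T F e : is_spanning_tree T -> {subset F <= T} ->
  ~~ linked F (fst_end e) (snd_end e) ->
  exists2 f, f \in T `\` F & ~~ linked (T `\ f) (fst_end e) (snd_end e).
Proof.
move=> tT; move kE : (#|` T `\` F|) => k.
elim: k F kE => [|k IH] F kE FT nF.
  have TF : T `<=` F by rewrite -fsetD_eq0 -cardfs_eq0 kE.
  case/negP: nF; apply: linked_sub (tree_linked _ _ tT) => x xT.
  exact: (fsubsetP TF).
have [f fTF] : exists f, f \in T `\` F.
  by case: (fset_0Vmem (T `\` F)) => [h|[f]]; [rewrite h cardfs0 in kE|exists f].
have [fF fT] : f \notin F /\ f \in T by move: fTF; rewrite inE => /andP[].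
have [lf|nf] := boolP (linked (f |` F) (fst_end e) (snd_end e)); last first.
  have [||h hT hn] := IH (f |` F) _ _ nf.
  - rewrite fsetUC -fsetDDl; have := cardfsD1 f (T `\` F).
    by rewrite fTF kE /= => -[].
  - by move=> x; rewrite in_fset1U => /orP[/eqP->//|/FT].
  exists h => //; move: hT => /fsetDP[hT]; rewrite in_fset1U negb_or => /andP[_ hF].
  exact/fsetDP.
exists f => //.
have sF : {subset F <= T `\ f}.
  move=> x xF; have xT := FT x xF; apply/fsetD1P; split=> //.
  by apply: contraNneq fF => <-.
apply/negP => le.
have := tree_unlinked tT fT; apply/negP; rewrite negbK.
have := @linked_exchange F e f (fst_end e) (snd_end e) _ nF lf.
rewrite linked_edge ?in_fset1U ?eqxx // => /(_ isT).
apply: linked_closure => g; rewrite in_fset1U => /orP[/eqP->//|/sF].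
exact: linked_edge.
Qed.

Lemma weight_swap (R : realType) (c : medge n -> R) T e f : e \in T ->
  f \notin T `\ e -> weight c (f |` (T `\ e)) = weight c T - c e + c f.
Proof.
move=> eT fT; rewrite /weight big_fsetU1 //= [in RHS](big_fsetD1 e) //=.
by ring.
Qed.

(** If losing [e] cuts its end [w] off from [r], then [e] is the last edge of the tree path from [r]
    to [w], and that path has only one last edge. *)
Lemma far_endpoint_inj T r e f w : is_spanning_tree T ->
  e \in T -> f \in T -> e != f ->
  (w == fst_end e) || (w == snd_end e) -> ~~ linked (T `\ e) r w ->
  (w == fst_end f) || (w == snd_end f) -> ~~ linked (T `\ f) r w -> False.
Proof.
move=> tT eT fT ef we nwe wf nwf.
set H := (T `\ e) `\ f.
have TeE : T `\ e = f |` H by rewrite /H fsetD1K // in_fsetD1 eq_sym ef.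
have TfE : T `\ f = e |` H.
  apply/fsetP => x; rewrite in_fset1U /H !in_fsetD1.
  by have [->|_] := eqVneq x e; rewrite ?ef ?eT.
have sH g x y : linked H x y -> linked (g |` H) x y.
  by apply: linked_sub => z zH; rewrite in_fset1U zH orbT.
have nH : ~~ linked H r w by apply: contra nwe; rewrite TeE; apply: sH.
(* [a] is the end of [g] other than [w]; [linked_add] is restated with [w] and [a] to treat both
   orientations of [g] at once. *)
have other g : (w == fst_end g) || (w == snd_end g) ->
    exists2 a, linked (g |` H) a w &
    forall F x y, linked (g |` F) x y -> [\/ linked F x y,
      linked F x w /\ linked F a y | linked F x a /\ linked F w y].
  have gg : linked (g |` H) (fst_end g) (snd_end g).
    by apply: linked_edge; rewrite in_fset1U eqxx.
  case/orP => /eqP wE; [exists (snd_end g)|exists (fst_end g)].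
  - by rewrite linked_sym wE.
  - by rewrite wE => F x y; apply: linked_add.
  - by rewrite wE.
  - rewrite wE => F x y /linked_add[]; [constructor 1|constructor 3|constructor 2] => //.
have [a aw addE] := other e we.
have [b bw addF] := other f wf.
have lT : linked (e |` (T `\ e)) r w by rewrite fsetD1K //; apply: tree_linked.
have ra : linked (f |` H) r a.
  case: (addE _ _ _ lT) => [h|[h _]|[h _]]; [by rewrite h in nwe..|].
  by rewrite -TeE.
case: (addF _ _ _ ra) => [h|[h _]|[_ h]].
- by move: nwf; rewrite TfE (connect_trans (sH e _ _ h) aw).
- by rewrite h in nH.
- case/negP: nwe; rewrite TeE; apply: connect_trans ra _.
  by rewrite linked_sym; apply: sH.
Qed.

End Connectivity.

(** * Kruskal's layers and their agreement with greedy minimum spanning trees *)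

Section Layers.
Variables (R : realType) (n : nat).
Implicit Types (c : medge n -> R) (A D : medge n -> Prop) (s t : R)
  (p : vpair n) (e f : medge n) (F : {fset medge n}).

(** [A] may be infinite, so a finite [F] witnesses the connection. The inequality is strict so that
    an edge does not join its own ends at the level of its cost. *)
Definition reach c A s p := exists2 F : {fset medge n},
  (forall f, f \in F -> A f /\ c f < s) & linked F (val p).1 (val p).2.

(* The edges of [D] left over by the first [i] greedy forests, in Kruskal's
   description: an edge survives a layer when cheaper edges of that layer
   already join its ends. *)
Fixpoint avail c D (i : nat) (e : medge n) : Prop :=
  if i is j.+1 then avail c D j e /\ reach c (avail c D j) (c e) e.1 else D e.

Lemma reach_mono c A B s t p : s <= t -> (forall e, c e < s -> A e -> B e) ->
  reach c A s p -> reach c B t p.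
Proof.
move=> st AB [F AF lF]; exists F => // f /AF[Af fs].
by split; [exact: AB|exact: lt_le_trans st].
Qed.

Lemma avail_le c D i j e : (j <= i)%N -> avail c D i e -> avail c D j e.
Proof.
move=> ji; rewrite -(subnK ji); elim: (i - j)%N => [//|k IH].
by rewrite addSn => -[/IH].
Qed.

(** The layers are nested, so edges of layer [i] that join the ends of [e] do so in all earlier
    layers too: the last condition in [avail] implies the others. *)
Lemma availS c D i e :
  avail c D i.+1 e <-> D e /\ reach c (avail c D i) (c e) e.1.
Proof.
split=> [[h r]|[De r]]; first by split=> //; apply: (avail_le (leq0n i) h).
split=> //; move: r; elim: i => [//|i IH] r.
have r' : reach c (avail c D i) (c e) e.1.
  by apply: reach_mono (lexx _) _ r => f _ [].
by split=> //; exact: IH.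
Qed.

(** The fate of an edge is decided by cheaper edges alone, so changes of [D] at costs from [s] on go
    unnoticed below [s]. *)
Lemma avail_local c D D' s : (forall e, c e < s -> D e -> D' e) ->
  (forall e, c e < s -> D' e -> D e) ->
  forall i e, c e < s -> avail c D i e <-> avail c D' i e.
Proof.
move=> DD' D'D; elim=> [e es|i IH e es] /=.
  by split; [exact: DD'|exact: D'D].
rewrite IH //; split=> -[h r]; split=> //; apply: reach_mono (lexx _) _ r => f fe.
  by move/IH; apply; exact: lt_trans fe es.
by move/IH; apply; exact: lt_trans fe es.
Qed.

Lemma reach_local c D D' s i p : (forall e, c e < s -> D e -> D' e) ->
  (forall e, c e < s -> D' e -> D e) ->
  reach c (avail c D i) s p <-> reach c (avail c D' i) s p.
Proof.
move=> DD' D'D.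
by split; apply: reach_mono (lexx _) _ => e es /(avail_local DD' D'D i es).
Qed.

Lemma reach_edge c A s e : A e -> c e < s -> reach c A s e.1.
Proof.
move=> Ae es; exists [fset e]; last by apply: linked_edge; rewrite in_fset1.
by move=> f; rewrite in_fset1 => /eqP ->.
Qed.

(** By induction the parallel edge [(p, i)] survives [i] layers, and it then joins the ends of every
    later copy in the next layer. *)
Lemma avail_index c D p i m :
  (forall l l', (l < l')%N -> c (p, l) < c (p, l')) ->
  (forall l, D (p, l)) -> (i <= m)%N -> avail c D i (p, m).
Proof.
move=> cp Dp; elim: i m => [m _|i IH m im]; first exact: Dp.
apply: (@availS c D i (p, m)).2; split=> //.
by apply: (@reach_edge c (avail c D i) _ (p, i)); [exact: IH|exact: cp].
Qed.

Section Greedy.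
Variables (c : medge n -> R) (T : nat -> {fset medge n}).
Hypotheses (cinj : injective c) (gT : greedy_MSTs c T).

Lemma greedy_spanning i : is_spanning_tree (T i).
Proof. by case: (gT i). Qed.

(** Cut property: if [F] linked [u] and [v], some [f] in [F] would cross the cut left by [e], and
    swapping [e] for the cheaper [f] would lower the weight. *)
Lemma greedy_unreached i e F : e \in T i ->
  (forall f, f \in F -> (forall j, (j < i)%N -> f \notin T j) /\ c f < c e) ->
  forall u v, ~~ linked (T i `\ e) u v -> ~~ linked F u v.
Proof.
move=> eT HF u v nT; apply/negP => lF.
have [f fF nf] := unlinked_edge lF nT.
have [favail fe] := HF f fF.
have [tT [Tav minT]] := gT i.
have fT : f \notin T i `\ e by apply: contra nf; apply: linked_edge.
have : weight c (T i) <= weight c (f |` (T i `\ e)).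
  apply: minT; first exact: tree_swap.
  move=> g; rewrite in_fset1U => /orP[/eqP->//|/fsetD1P[_]]; exact: Tav.
by rewrite (weight_swap _ eT fT); lra.
Qed.

(** Cycle property: otherwise some tree edge dearer than [e] could be swapped for [e]. *)
Lemma greedy_reached i e : (forall j, (j <= i)%N -> e \notin T j) ->
  linked [fset f in T i | c f < c e] (fst_end e) (snd_end e).
Proof.
move=> eT; apply: contrapT => /negP nl.
have [tT [Tav minT]] := gT i.
set F := [fset f in T i | c f < c e]%fset in nl *.
have FT : {subset F <= T i} by move=> x; rewrite in_fset => /andP[].
have [f fTF nf] := tree_exchange tT FT nl.
have [fT fF] : f \in T i /\ f \notin F by case/fsetDP: fTF.
have eT' : e \notin T i `\ f by apply: contra (eT i (leqnn i)) => /fsetD1P[].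
have cfe : c e < c f.
  rewrite lt_neqAle; apply/andP; split.
    by apply: contraNneq (eT i (leqnn i)) => /cinj ->.
  by rewrite leNgt; apply: contra fF => h; rewrite in_fset; apply/andP.
have : weight c (T i) <= weight c (e |` (T i `\ f)).
  apply: minT; first exact: tree_swap.
  move=> g; rewrite in_fset1U => /orP[/eqP-> j ji|/fsetD1P[_]]; last exact: Tav.
  by apply: eT; apply: ltnW.
by rewrite (weight_swap _ fT eT'); lra.
Qed.

(** Induction on the layer, by the cut property one way and the cycle property the other. The
    leftover edges are thus a function of the costs alone. *)
Lemma greedy_avail i e :
  avail c (fun=> True) i e <-> (forall j, (j < i)%N -> e \notin T j).
Proof.
elim: i e => [|i IH] e; first by [].
rewrite /=; split.
  case=> /IH eT [F HF lF] j; rewrite ltnS leq_eqVlt => /orP[/eqP ->|/eT//].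
  apply/negP => eTi.
  apply/negP: lF.
  apply: (greedy_unreached eTi _ (tree_unlinked (greedy_spanning i) eTi)).
  by move=> f /HF[/IH].
move=> eT; split; first by apply/IH => j ji; apply: eT; exact: ltnW.
exists [fset f in T i | c f < c e]; last exact: greedy_reached.
move=> f; rewrite in_fset => /andP[fT fe]; split=> //.
by apply/IH; have [_ [Tav _]] := gT i; exact: Tav.
Qed.

Lemma greedy_cut i e p : e \in T i ->
  ~~ linked (T i `\ e) (val p).1 (val p).2 ->
  ~ reach c (avail c (fun=> True) i) (c e) p.
Proof.
move=> eT nl [F HF]; apply/negP; apply: greedy_unreached eT _ _ _ nl.
by move=> f /HF[/greedy_avail].
Qed.

Lemma greedy_disjoint i j e : e \in T i -> e \in T j -> i = j.
Proof.
wlog ij : i j / (i < j)%N.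
  move=> H ei ej; have [|ij|//] := ltngtP i j; first by move/H; apply.
  by apply/esym/H.
move=> ei ej; have [_ [Tav _]] := gT j.
by have := Tav e ej i ij; rewrite ei.
Qed.

(** Copies of index above [i] survive the layers up to [i]. Hence finite sums over [l < K] see all
    edges of the first [K] trees. *)
Lemma greedy_index i e : (forall p l l', (l < l')%N -> c (p, l) < c (p, l')) ->
  e \in T i -> (e.2 <= i)%N.
Proof.
move=> cp eT; rewrite leqNgt; apply/negP => ie.
have : avail c (fun=> True) i.+1 (e.1, e.2) by apply: avail_index => // l l'; exact: cp.
by rewrite -surjective_pairing => /greedy_avail/(_ i (ltnSn i)); rewrite eT.
Qed.

End Greedy.
End Layers.

(** * Weights of the greedy trees *)

Section TreeWeight.
Variables (R : realType) (n : nat) (c : medge n -> R) (T : nat -> {fset medge n}).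
Hypothesis gT : greedy_MSTs c T.
Hypothesis cinj : injective c.

Let joins (p : vpair n) (r w : 'I_n) := (val p == (r, w)) || (val p == (w, r)).

(** Both orders of the ends count, which produces the factor 2 in [greedy_weight_le]. *)
Let joins_count (p : vpair n) : (\sum_r \sum_w (joins p r w : nat) = 2)%N.
Proof.
have := valP p; case pE: (val p) => [a b] /= ab.
have nab : a != b by apply: contraTneq ab => ->; rewrite ltnn.
have E r w : (joins p r w : nat) = ((r == a) * (w == b) + (r == b) * (w == a))%N.
  rewrite /joins pE !xpair_eqE ![_ == r]eq_sym ![_ == w]eq_sym.
  have [->|ra] := eqVneq r a; rewrite /= ?(negbTE nab) ?andbF ?mul0n ?addn0 ?orbF ?mul1n //.
  by rewrite andbC mulnb.
have S1 (x : 'I_n) : (\sum_r (r == x) = 1)%N.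
  by rewrite (bigD1 x) //= eqxx big1 // => i /negbTE ->.
under eq_bigr do under eq_bigr do rewrite E.
under eq_bigr do rewrite big_split /= -!big_distrr /= !S1 !muln1.
by rewrite big_split /= !S1.
Qed.

(* Every root [r] sends each tree edge [e] injectively to the pair formed by [r]
   and the end of [e] that is farther from [r], whose ends [e] separates. *)
Lemma greedy_weight_le (G : vpair n -> R) (i : nat) :
  (forall p, 0 <= G p) ->
  (forall p s, ~ reach c (avail c (fun=> True) i) s p -> s <= G p) ->
  n%:R * weight c (T i) <= 2 * \sum_p G p.
Proof.
move=> G0 GS.
have tT := greedy_spanning gT i.
(* The value of [G] at the pair formed by [r] and [w], as a sum so that it is 0 when [r = w]. *)
pose g r w := \sum_(p | joins p r w) G p.
have g0 r w : 0 <= g r w by apply: sumr_ge0.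
have sumg : \sum_r \sum_w g r w = 2 * \sum_p G p.
  rewrite /g; under eq_bigr do under eq_bigr do rewrite big_mkcond.
  under eq_bigr do rewrite exchange_big /=.
  rewrite exchange_big /= big_distrr /=; apply: eq_bigr => p _.
  rewrite -[2]/(2%:R) -(joins_count p) natr_sum big_distrl /=.
  apply: eq_bigr => r _; rewrite natr_sum big_distrl /=.
  by apply: eq_bigr => w _; case: ifP => _; rewrite ?mul1r ?mul0r.
have sepE r e : e \in T i -> exists w,
    ((w == fst_end e) || (w == snd_end e)) && ~~ linked (T i `\ e) r w.
  move=> eT; have nl := tree_unlinked tT eT.
  have [l1|l1] := boolP (linked (T i `\ e) r (fst_end e)).
    exists (snd_end e); rewrite eqxx orbT /=; apply: contra nl.
    by apply: connect_trans; rewrite linked_sym.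
  by exists (fst_end e); rewrite eqxx.
have -> : n%:R * weight c (T i) = \sum_(r < n) weight c (T i).
  by rewrite sumr_const card_ord mulr_natl.
rewrite -sumg; apply: ler_sum => r _.
pose far e := odflt r [pick w | ((w == fst_end e) || (w == snd_end e)) &&
  ~~ linked (T i `\ e) r w].
have farP e : e \in T i -> ((far e == fst_end e) || (far e == snd_end e)) &&
    ~~ linked (T i `\ e) r (far e).
  move=> eT; rewrite /far; case: pickP => [//|h].
  by case: (sepE r e eT) => w; rewrite h.
have le_far e : e \in T i -> c e <= g r (far e).
  move=> eT; have /andP[_ nl] := farP e eT.
  have nr : r != far e by apply: contraNneq nl => <-; rewrite connect0.
  have [p pj] : exists p, joins p r (far e).
    have [lt|gt|eq] := ltngtP (r : nat) (far e).
    - by exists (exist (fun q : 'I_n * 'I_n => (q.1 < q.2)%N) (r, far e) lt); rewrite /joins eqxx.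
    - by exists (exist (fun q : 'I_n * 'I_n => (q.1 < q.2)%N) (far e, r) gt); rewrite /joins eqxx orbT.
    - by case/eqP: nr; apply: val_inj.
  have cG : c e <= G p.
    apply: GS; apply: (greedy_cut cinj gT eT).
    by case/orP: pj => /eqP -> //=; rewrite linked_sym.
  apply: le_trans cG _; rewrite /g (bigD1 p) //= lerDl; exact: sumr_ge0.
have uniq_far : uniq [seq far e | e <- enum_fset (T i)].
  rewrite map_inj_in_uniq; first exact: fset_uniq.
  move=> e f eT fT ef.
  apply: contrapT => /eqP nef.
  have /andP[we nwe] := farP e eT; have /andP[wf nwf] := farP f fT.
  rewrite ef in we nwe.
  exact: (far_endpoint_inj tT eT fT nef we nwe wf nwf).
rewrite /weight; apply: (@le_trans _ _ (\sum_(e <- enum_fset (T i)) g r (far e))).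
  by rewrite big_seq [leRHS]big_seq; apply: ler_sum => e; exact: le_far.
rewrite -(big_map far xpredT (g r)) big_uniq //= [leRHS](bigID (mem [seq far e | e <- enum_fset (T i)])) /=.
by rewrite lerDl; apply: sumr_ge0.
Qed.

(** The accepted edges are those of the first [K] trees, which are disjoint and use only indices
    below [K], so this is a reindexing. *)
Lemma sum_accepted (h : medge n -> R) (K : nat) :
  (forall p l l', (l < l')%N -> c (p, l) < c (p, l')) ->
  \sum_p \sum_(l < K) (if `[< avail c (fun=> True) K (p, val l) >] then 0 else h (p, val l)) =
  \sum_(j < K) \sum_(e <- enum_fset (T j)) h e.
Proof.
move=> cp.
pose E (x : vpair n * 'I_K) : medge n := (x.1, val x.2).
have Einj : injective E by move=> [p l] [p' l'] [-> /val_inj ->].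
have step p (l : 'I_K) :
    (if `[< avail c (fun=> True) K (p, val l) >] then 0 else h (p, val l)) =
    \sum_(j < K) (if E (p, l) \in T j then h (p, val l) else 0).
  case: asboolP => [/(greedy_avail cinj gT) eT|eT].
    by rewrite big1 // => j _; rewrite (negbTE (eT j (ltn_ord j))).
  have [j /negP jT] : exists j : 'I_K, ~ (E (p, l) \notin T j).
    apply: contrapT => nj; apply: eT; apply/(greedy_avail cinj gT) => j jK.
    by apply: contrapT => h'; apply: nj; exists (Ordinal jK).
  rewrite negbK in jT; rewrite (bigD1 j) //= jT big1 ?addr0 // => j' j'j.
  case: ifPn => // j'T; case/eqP: j'j; apply: val_inj.
  exact: (greedy_disjoint gT j'T jT).
under eq_bigr do under eq_bigr do rewrite step.
rewrite pair_big /= exchange_big /=; apply: eq_bigr => j _.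
rewrite -big_mkcond /= (eq_bigr (fun x => h (E x))); last by case.
rewrite (eq_bigl (fun x => E x \in T j)); last by case.
rewrite -big_filter -(big_map E xpredT h).
apply: perm_big; apply: uniq_perm.
- by rewrite map_inj_uniq //; apply: filter_uniq; exact: index_enum_uniq.
- exact: fset_uniq.
move=> e; apply/mapP/idP => [[x]|eT]; first by rewrite mem_filter => /andP[xT _ ->].
have lt : (e.2 < K)%N by apply: leq_ltn_trans (greedy_index cinj gT cp eT) (ltn_ord j).
exists (e.1, Ordinal lt); last by rewrite /E /= -surjective_pairing.
by rewrite mem_filter mem_index_enum andbT /E /= -surjective_pairing.
Qed.

(** The sum of [c e - t] over the [K * n.-1] accepted edges is at least minus the sum of the
    positive parts of [t - c e] over all edges of index below [K]. *)
Lemma sum_weight_ge (K : nat) (t : R) :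
  (forall p l l', (l < l')%N -> c (p, l) < c (p, l')) ->
  (K * n.-1)%:R * t - \sum_p \sum_(l < K) Num.max (t - c (p, val l)) 0 <=
  \sum_(j < K) weight c (T j).
Proof.
move=> cp; have := sum_accepted (fun e => c e - t) K cp.
have -> : \sum_(j < K) \sum_(e <- enum_fset (T j)) (c e - t) =
    \sum_(j < K) weight c (T j) - (K * n.-1)%:R * t.
  have -> : (K * n.-1)%:R * t = \sum_(j < K) (n.-1)%:R * t.
    by rewrite sumr_const card_ord natrM -mulrA mulr_natl.
  rewrite -sumrB.
  apply: eq_bigr => j _; rewrite sumrB /weight; congr (_ - _).
  rewrite big_const_seq count_predT iter_addr_0 mulr_natl; congr (_ *+ _).
  by case/andP: (greedy_spanning gT j) => /eqP.
have le : - (\sum_p \sum_(l < K) Num.max (t - c (p, val l)) 0) <=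
  \sum_p \sum_(l < K) (if `[< avail c (fun=> True) K (p, val l) >] then 0 else c (p, val l) - t).
  rewrite -sumrN; apply: ler_sum => p _; rewrite -sumrN; apply: ler_sum => l _.
  by case: ifP => _; case: (leP (t - c (p, val l)) 0) => /=; lra.
by move=> E; rewrite E in le; lra.
Qed.

Lemma card_accepted (K : nat) :
  (forall p l l', (l < l')%N -> c (p, l) < c (p, l')) ->
  \sum_p \sum_(l < K) (if `[< avail c (fun=> True) K (p, val l) >] then 0 else 1) =
  (K * n.-1)%:R :> R.
Proof.
move=> cp; rewrite (sum_accepted (fun=> 1) K cp) natrM mulr_natl.
have -> : (n.-1)%:R *+ K = \sum_(j < K) (n.-1)%:R :> R by rewrite sumr_const card_ord.
apply: eq_bigr => j _; rewrite big_const_seq count_predT iter_addr_0; congr (_ *+ _).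
by case/andP: (greedy_spanning gT j) => /eqP.
Qed.

End TreeWeight.

(** * Joining times, gains and their telescoping sums *)

Section Slack.
Variables (R : realType) (n : nat).
Implicit Types (c : medge n -> R) (D : medge n -> Prop) (p : vpair n).

(* The distance from [t] to the time at which layer [i] joins the ends of [p]. *)
Definition slack c D i p (t : R) : \bar R :=
  ereal_inf [set x%:E | x in [set x | reach c (avail c D i) (t + x) p]].

(** The minimum of [x] and the positive part of [b]; here [b] is [+oo] if the ends are never
    joined. *)
Definition gain (b : \bar R) (x : R) : \bar R := mine (maxe b 0) x%:E.

(** Finitely many costs below [s] leave room below [s]. So the infimum in [slack] is not attained,
    and lying strictly above it is equivalent to [reach]. *)
Lemma reach_open c (A : medge n -> Prop) s p : reach c A s p ->
  exists2 t, t < s & reach c A t p.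
Proof.
case=> F HF lF.
have [t ts Ht] : exists2 t, t < s & forall f, f \in enum_fset F -> c f < t.
  have : forall f, f \in enum_fset F -> c f < s by move=> f /HF[].
  elim: (enum_fset F) => [|g l IH] H; first by exists (s - 1) => //; lra.
  have [|t ts Ht] := IH; first by move=> f fl; apply: H; rewrite in_cons fl orbT.
  have gs : c g < s by apply: H; rewrite in_cons eqxx.
  exists (Num.max t ((c g + s) / 2)); first by rewrite gt_max ts /=; lra.
  move=> f; rewrite in_cons lt_max => /orP[/eqP->|/Ht -> //].
  by apply/orP; right; lra.
by exists t => //; exists F => // f fF; split; [case: (HF f fF)|exact: Ht].
Qed.

Lemma slack_lt c D i p t x :
  (slack c D i p t < x%:E)%E <-> reach c (avail c D i) (t + x) p.
Proof.
split=> [/ereal_inf_lt[_ [y ry <-]]|/reach_open[s sx rs]].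
  by rewrite lte_fin => yx; apply: reach_mono _ _ ry => //; lra.
apply: (@le_lt_trans _ _ (s - t)%:E); last by rewrite lte_fin; lra.
by apply: ereal_inf_lbound; exists (s - t) => //=; rewrite addrC subrK.
Qed.

Lemma gain_ge0 b x : 0 <= x -> (0 <= gain b x)%E.
Proof. by move=> x0; rewrite /gain le_min le_max lexx orbT lee_fin. Qed.

Lemma gain_fin b x : 0 <= x -> gain b x \is a fin_num.
Proof.
move=> x0; apply/fin_numPlt; rewrite (lt_le_trans _ (gain_ge0 b x0)) ?ltNy0 //=.
by rewrite /gain gt_min ltry orbT.
Qed.

Section Process.
Variables (x : medge n -> R).
Hypothesis xpos : forall e, 0 < x e.

Definition cum (p : vpair n) (l : nat) : R := \sum_(j < l) x (p, nat_of_ord j).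
Definition cumcost (e : medge n) : R := cum e.1 e.2.+1.
(* Ignoring the edges of [p] from the [l]-th on makes [slack] independent of
   the interarrival time [x (p, l)]. *)
Definition before (p : vpair n) (l : nat) (e : medge n) : Prop :=
  e.1 <> p \/ (e.2 < l)%N.

Lemma cumS p l : cum p l.+1 = cum p l + x (p, l).
Proof. by rewrite /cum big_ord_recr. Qed.

Lemma cum_le p l l' : (l <= l')%N -> cum p l <= cum p l'.
Proof.
move=> ll'; rewrite -(subnK ll'); elim: (l' - l)%N => [|k IH]; first by rewrite add0n.
by rewrite addSn cumS; apply: le_trans IH _; rewrite lerDl ltW.
Qed.

Lemma cumcost_lt p l l' : (l < l')%N -> cumcost (p, l) < cumcost (p, l').
Proof.
move=> ll'; rewrite /cumcost /= [ltRHS]cumS.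
by apply: le_lt_trans (cum_le p ll') _; rewrite ltrDl.
Qed.

(** The discarded edges of [p] cost at least [cum p l.+1], so they are not felt up to that level. *)
Lemma reach_before p l i s : s <= cum p l.+1 ->
  reach cumcost (avail cumcost (before p l) i) s p <->
  reach cumcost (avail cumcost (fun=> True) i) s p.
Proof.
move=> sl; apply: reach_local => // -[q m] es _.
have [qp|] := pselect (q = p); last by left.
subst q.
right; rewrite ltnNge /=; apply/negP => lm.
by have := lt_le_trans es sl; rewrite /cumcost /= ltNge cum_le.
Qed.

(** The edge arrives at [cum p l + x (p, l)] and is rejected when layer [i] joins its ends before
    that; neither the edge itself nor a later copy can contribute. *)
Lemma rejected_slack p l i :
  avail cumcost (fun=> True) i.+1 (p, l) <->
  (slack cumcost (before p l) i p (cum p l) < (x (p, l))%:E)%E.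
Proof.
rewrite availS slack_lt -cumS (@reach_before p l i (cum p l.+1)) //.
by split=> [[]|].
Qed.

(* Before the ends of [p] are joined, the edges of [p] come fast enough for their
   gains to telescope. *)
Lemma gain_ge i p s : ~ reach cumcost (avail cumcost (fun=> True) i) s p ->
  s <= \sum_(l < i.+1) fine (gain (slack cumcost (before p l) i p (cum p l)) (x (p, nat_of_ord l))).
Proof.
move=> nr.
(* The part below [s] of an interval between arrivals is at most the interarrival time, and at most
   the slack because the ends of [p] are not yet joined at [s]. *)
have step l : Num.min s (cum p l.+1) - Num.min s (cum p l) <=
    fine (gain (slack cumcost (before p l) i p (cum p l)) (x (p, l))).
  have x0 := ltW (xpos (p, l)).
  rewrite -lee_fin fineK ?gain_fin //.
  have [sl|ls] := leP s (cum p l).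
    rewrite (_ : _ - _ = 0); first exact: gain_ge0.
    by rewrite min_l ?subrr //; apply: le_trans sl (cum_le p (leqnSn l)).
  rewrite /gain le_min; apply/andP; split; last first.
    by rewrite lee_fin cumS; have [|] := leP s (cum p l + x (p, l)); lra.
  rewrite le_max; apply/orP; left; rewrite leNgt; apply/negP => /slack_lt.
  rewrite addrC subrK => /reach_before h; apply: nr.
  by apply: reach_mono _ _ (h _) => //; rewrite ge_min lexx ?orbT.
(* Beyond this level [(p, i)], which survives [i] layers, joins the ends of [p]. *)
have sK : s <= cum p i.+1.
  rewrite leNgt; apply/negP => lt; apply: nr.
  apply: (@reach_edge _ _ cumcost _ s (p, i)) => //.
  by apply: avail_index => // l l'; exact: cumcost_lt.
apply: (@le_trans _ _ (\sum_(l < i.+1) (Num.min s (cum p l.+1) - Num.min s (cum p l)))); last first.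
  by apply: ler_sum => l _; exact: step.
rewrite -(big_mkord xpredT (fun l => Num.min s (cum p l.+1) - Num.min s (cum p l))).
rewrite (telescope_sumr (fun l => Num.min s (cum p l))) //.
have := min_l sK; rewrite /cum big_ord0 => ->.
by have : Num.min s 0 <= 0; [rewrite ge_min lexx orbT|lra].
Qed.

End Process.
End Slack.

Close Scope fset_scope.

(** * Independence of one variable from the sigma-algebra of the others *)

Section Independence.
Context (R : realType) (d : measure_display) (Ω : measurableType d)
  (P : probability Ω R) (I : choiceType) (X : I -> Ω -> R).
Hypotheses (mX : forall i, measurable_fun setT (X i))
  (indepX : mutually_independent P X).
Variable i0 : I.

Definition cylinders : set (set Ω) := [set A | exists (F : {fset I}) (B : I -> set R),
  [/\ i0 \notin F, forall i, i \in F -> measurable (B i)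
    & A = \bigcap_(i in [set` F]) (X i @^-1` B i)]].

(* The sample space with the sigma-algebra generated by all [X i], [i != i0]. *)
Definition others := g_sigma_algebraType cylinders.

Lemma measurable_preim i (B : set R) : measurable B -> measurable (X i @^-1` B).
Proof. by move=> mB; rewrite -[X in measurable X]setTI; exact: mX. Qed.

Lemma cylinders_measurable : cylinders `<=` measurable.
Proof.
move=> A [F [B [_ mB ->]]]; apply: fin_bigcap_measurable => [|i /= iF].
  exact: finite_fset.
exact: measurable_preim (mB i iF).
Qed.

Lemma cylindersT : cylinders setT.
Proof.
exists fset0, (fun=> setT); split=> //.
by apply/seteqP; split => // x.
Qed.

Lemma cylindersI : setI_closed cylinders.
Proof.
move=> A A' [F [B [i0F mB ->]]] [F' [B' [i0F' mB' ->]]].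
exists (F `|` F')%fset, (fun i => (if i \in F then B i else setT) `&`
  (if i \in F' then B' i else setT)).
split.
- by rewrite in_fsetU negb_or i0F i0F'.
- by move=> i _; apply: measurableI; case: ifP => //; [exact: mB|exact: mB'].
apply/seteqP; split => w.
  case=> BA BA' i _ /=; split; case: ifP => // h; [exact: BA|exact: BA'].
move=> H; split=> i /= iF; have := H i; rewrite /= in_fsetU iF ?orbT /=;
  by move=> /(_ isT) [].
Qed.

Lemma cylinders_indep A B : cylinders A -> measurable B ->
  P (A `&` (X i0 @^-1` B)) = (P A * P (X i0 @^-1` B))%E.
Proof.
case=> F [B' [i0F mB' ->]] mB.
pose C i := if i == i0 then B else B' i.
have CF i : i \in F -> C i = B' i.
  by move=> iF; rewrite /C; case: eqP => // ii0; rewrite -ii0 iF in i0F.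
have -> : \bigcap_(i in [set` F]) (X i @^-1` B' i) = \bigcap_(i in [set` F]) (X i @^-1` C i).
  by apply: eq_bigcapr => i iF; rewrite CF.
have C0 : C i0 = B by rewrite /C eqxx.
have -> : (\bigcap_(i in [set` F]) (X i @^-1` C i)) `&` (X i0 @^-1` B) =
    \bigcap_(i in [set` (i0 |` F)%fset]) (X i @^-1` C i).
  apply/seteqP; split => w.
    case=> H Bw i /=; rewrite in_fset1U => /orP[/eqP ->|iF]; first by rewrite C0.
    exact: H.
  move=> H; split; last by rewrite -C0; apply: H; rewrite /= in_fset1U eqxx.
  by move=> i iF; apply: H; rewrite /= in_fset1U [_ \in _]iF orbT.
have mC i : i \in (i0 |` F)%fset -> measurable (C i).
  by rewrite in_fset1U => /orP[/eqP ->|iF]; rewrite ?C0 ?CF //; exact: mB'.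
rewrite indepX // indepX; last by move=> i iF; rewrite CF //; exact: mB'.
by rewrite big_fsetU1 //= C0 muleC.
Qed.

Lemma others_measurable A : <<s cylinders >> A -> measurable A.
Proof. exact: (smallest_sub (@sigma_algebra_measurable _ Ω) cylinders_measurable). Qed.

(** As functions of [A] both sides are finite measures; they agree on the cylinders, which are
    closed under intersection. *)
Lemma others_indep A B : <<s cylinders >> A -> measurable B ->
  P (A `&` (X i0 @^-1` B)) = (P A * P (X i0 @^-1` B))%E.
Proof.
move=> sA mB; have mXB := measurable_preim i0 mB.
pose r : {nonneg R} := NngNum (fine_ge0 (measure_ge0 P (X i0 @^-1` B))).
have rE : (r%:num%:E = P (X i0 @^-1` B))%E by rewrite fineK // fin_num_measure.
have mscaleE C : mscale r P C = (P C * P (X i0 @^-1` B))%E.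
  by rewrite /mscale /= -rE muleC.
rewrite -mscaleE -[LHS]/(mrestr P mXB A).
apply: (@g_sigma_algebra_measure_unique _ _ _ cylinders _ (fun=> setT)) sA => //.
- exact: cylinders_measurable.
- by move=> _; exact: cylindersT.
- by apply/seteqP; split => // x _; exists 0%N.
- exact: cylindersI.
- by move=> C CC; rewrite [RHS]mscaleE /= /mrestr cylinders_indep.
- move=> _; rewrite /= /mrestr setTI.
  by rewrite (le_lt_trans (probability_le1 P mXB)) // ltry.
Qed.

Lemma measurable_toothers : measurable_fun setT (fun w : Ω => w : others).
Proof. by move=> _ A mA; rewrite setTI; exact: others_measurable. Qed.

Lemma measurable_from_others d' (S : measurableType d') (f : others -> S) :
  measurable_fun setT f -> measurable_fun (setT : set Ω) (f : Ω -> S).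
Proof.
by move=> mf; exact: (measurableT_comp mf measurable_toothers).
Qed.

Lemma measurable_others i : i != i0 -> measurable_fun (setT : set others) (X i : others -> R).
Proof.
move=> ii0 _ B mB; rewrite setTI; apply: sub_sigma_algebra.
exists [fset i]%fset, (fun=> B); split=> //; first by rewrite in_fset1 eq_sym.
apply/seteqP; split => [w Bw j /= |w /(_ i)]; last by apply; rewrite /= in_fset1.
by rewrite in_fset1 => /eqP ->.
Qed.

Variable L : probability (R) R.
Hypothesis LE : forall B, measurable B -> P (X i0 @^-1` B) = L B.

Let joint (w : Ω) : others * R := (w : others, X i0 w).

Let mjoint : measurable_fun setT joint.
Proof. by apply: measurable_fun_pair; [exact: measurable_toothers|exact: mX]. Qed.

(** The joint law of the point of [others] and of [X i0] is a product measure, and Tonelli's theorem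
    integrates [X i0] out first. *)
Lemma indep_integral (f : others * R -> \bar R) :
  measurable_fun setT f -> (forall x, 0 <= f x)%E ->
  (\int[P]_w f (w : others, X i0 w) = \int[P]_w \int[L]_x f (w : others, x))%E.
Proof.
move=> mf f0.
pose toM : {mfun Ω >-> others} := HB.pack (fun w : Ω => w : others)
  (isMeasurableFun.Build _ _ _ _ _ measurable_toothers).
pose Q := distribution P toM.
pose joM : {mfun Ω >-> (others * R)%type} := HB.pack joint
  (isMeasurableFun.Build _ _ _ _ _ mjoint).
have prodE A : measurable A -> (Q \x L)%E A = distribution P joM A.
  apply: product_measure_unique => A1 A2 mA1 mA2.
  transitivity (P A1 * P (X i0 @^-1` A2))%E; first exact: others_indep.
  by congr (_ * _)%E; exact: LE.
transitivity (\int[distribution P joM]_z f z)%E.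
  by rewrite ge0_integral_distribution.
transitivity (\int[(Q \x L)%E]_z f z)%E.
  by apply: eq_measure_integral => A mA _; exact/esym/prodE.
rewrite fubini_tonelli1 // ge0_integral_distribution //.
  exact: measurable_fun_fubini_tonelli_F.
by move=> w; apply: integral_ge0.
Qed.

End Independence.

(** * Measurability of the layers and of the joining times *)

Section MeasurableSlack.
Context (R : realType) (n : nat) (d : measure_display) (S : measurableType d)
  (c : S -> medge n -> R) (D : medge n -> Prop).
Hypothesis mc : forall e, D e -> measurable_fun setT (fun w => c w e).

Lemma measurable_prop (A : Prop) : measurable [set w : S | A].
Proof.
by have [h|h] := pselect A; [rewrite (_ : mkset _ = setT) //|rewrite (_ : mkset _ = set0) //];
  apply/seteqP; split.
Qed.

Lemma measurable_lt (f g : S -> R) : measurable_fun setT f -> measurable_fun setT g ->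
  measurable [set w | f w < g w].
Proof.
move=> mf mg; have := measurable_fun_ltr mf mg.
by move=> /(_ measurableT [set true]); rewrite setTI; apply.
Qed.

(** A union over the countably many finite edge sets. Costs are measurable on [D] only, since over
    [others] the later copies of the pair involve the removed variable. *)
Lemma measurable_reach_of (A : S -> medge n -> Prop) (s : S -> R) p :
  (forall e, measurable [set w | A w e]) -> (forall w e, A w e -> D e) ->
  measurable_fun setT s -> measurable [set w | reach (c w) (A w) (s w) p].
Proof.
move=> mA AD ms.
rewrite (_ : mkset _ = \bigcup_(F : {fset medge n})
  ([set w | linked F (val p).1 (val p).2] `&`
   \bigcap_(f in [set` F]) [set w | A w f /\ c w f < s w])).
  apply: countable_bigcupT_measurable; first exact: countableP.
  move=> F; apply: measurableI.
    exact: measurable_prop.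
  apply: fin_bigcap_measurable; first exact: finite_fset.
  move=> f _; have [Df|nDf] := pselect (D f).
    rewrite -[mkset _]/([set w | A w f] `&` [set w | c w f < s w]).
    by apply: measurableI => //; apply: measurable_lt => //; exact: mc.
  by rewrite (_ : mkset _ = set0) //; apply/seteqP; split => // w [/AD].
apply/seteqP; split=> w.
  by case=> F HF lF; exists F => //; split=> // f /= fF; exact: HF.
by case=> F _ [lF HF]; exists F => // f fF; exact: HF.
Qed.

Lemma measurable_avail i e : measurable [set w | avail (c w) D i e].
Proof.
elim: i e => [e|i IH e]; first exact: measurable_prop.
have [De|nDe] := pselect (D e); last first.
  rewrite (_ : mkset _ = set0) //; apply/seteqP; split => // w h.
  exact/nDe/(avail_le (leq0n i.+1) h).
rewrite -[mkset _]/([set w | avail (c w) D i e] `&`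
  [set w | reach (c w) (avail (c w) D i) (c w e) e.1]).
apply: measurableI => //; apply: measurable_reach_of => //; last exact: mc.
by move=> w f h; exact: (avail_le (leq0n i) h).
Qed.

Lemma measurable_slack i p (t : S -> R) : measurable_fun setT t ->
  measurable_fun setT (fun w => slack (c w) D i p (t w)).
Proof.
move=> mt; apply: (measurability _ (ErealGenInftyO.measurableE R)).
move=> _ [_ [r ->] <-]; rewrite setTI.
rewrite (_ : _ @^-1` _ = [set w | reach (c w) (avail (c w) D i) (t w + r) p]).
  apply: measurable_reach_of; first exact: measurable_avail.
    by move=> w f h; exact: (avail_le (leq0n i) h).
  exact: measurable_funD.
by apply/seteqP; split => w /=; rewrite in_itv /=; [move/slack_lt|move=> ?; apply/slack_lt].
Qed.

End MeasurableSlack.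

(** * The expected gain for an exponential interarrival time *)

Section ExponentialGain.
Context (R : realType) (L : probability R R).
Hypothesis LE : forall B : set R, measurable B -> L B = exponential_prob 1 B.

Lemma exp_law_set1 (r : R) : L [set r] = 0%E.
Proof. by rewrite LE // /exponential_prob integral_set1. Qed.

Lemma exp_law_lt0 : L `]-oo, 0[%classic = 0%E.
Proof.
rewrite LE // /exponential_prob integral0_eq // => x /=; rewrite in_itv /= => x0.
by rewrite lt0_exponential_pdf.
Qed.

Lemma exp_law_tail (r : R) : 0 <= r -> L `]r, +oo[%classic = (exponential_pdf 1 r)%:E.
Proof.
move=> r0; rewrite exponential_pdfE // mul1r.
have Lr : L `]-oo, r]%classic = (1 - (expR (- 1 * r))%:E)%E.
  have -> : `]-oo, r]%classic = `]-oo, 0[%classic `|` `[0, r]%classic :> set R.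
    apply/seteqP; split => x /=; rewrite !in_itv /=.
      by move=> xr; have [x0|x0] := ltP x 0; [left|right].
    by case=> [/ltW x0|/andP[]//]; exact: le_trans x0 r0.
  rewrite measureU //; last first.
    apply/seteqP; split => // x /=; rewrite !in_itv /= => -[x0 /andP[]].
    by rewrite leNgt x0.
  rewrite [X in (X + _)%E = _](_ : _ = 0%E); last exact: exp_law_lt0.
  rewrite add0e; have [<-|r0'] := eqVneq 0 r.
    rewrite mulr0 expR0 subee // set_itv1; exact: exp_law_set1.
  by rewrite [LHS]LE // exponential_prob_itv0c // lt_neqAle r0'.
have : L `]r, +oo[%classic = (1 - L `]-oo, r]%classic)%E.
  by rewrite -probability_setC // setCitvl.
by rewrite Lr => ->; rewrite oppeB // addeA subee // add0e.
Qed.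

(* The tail of Exp(1) is its own density, so both sides are the integral of the
   density over [0, b). *)
Lemma exp_gain (b : \bar R) :
  (\int[L]_x gain b (Num.max x 0%R) = L [set x : R | (x%:E <= b)%E])%E.
Proof.
have max0 (x : R) : 0 <= Num.max x 0 by rewrite le_max lexx orbT.
pose f (x : R) : R := fine (gain b (Num.max x 0)).
have fE x : (f x)%:E = gain b (Num.max x 0) by rewrite fineK // gain_fin.
have mf : measurable_fun setT f.
  apply: measurableT_comp; first exact: fine_measurable.
  apply: measurable_mine; first exact: measurable_cst.
  by apply/measurable_EFinP; exact: measurable_maxr.
pose fM : {mfun R >-> R} := HB.pack f (isMeasurableFun.Build _ _ _ _ _ mf).
under eq_integral do rewrite -fE.
have -> : (\int[L]_x (f x)%:E = 'E_L[fM])%E by rewrite expectation_def.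
rewrite ge0_expectation_ccdf; last by move=> x; rewrite /= fine_ge0 // gain_ge0.
(* The expectation is the integral of the tail, and for [r >= 0] the gain exceeds [r] exactly when
   both [b] and [x] do. *)
have ccdfE (r : R) : 0 <= r -> ccdf (P := L) fM r =
    (if (r%:E < b)%E then (exponential_pdf 1 r)%:E else 0)%E.
  move=> r0; rewrite -exp_law_tail // /ccdf /distribution /pushforward /=.
  have [rb|br] := ltP r%:E b; last first.
    rewrite (_ : _ @^-1` _ = set0) ?measure0 //; apply/seteqP; split => // x /=.
    rewrite in_itv /= andbT -lte_fin fE /gain lt_min lt_max => /andP[/orP[|]].
      by rewrite ltNge br.
    by move=> h _; have := le_lt_trans (r0 : (0 <= r%:E)%E) h; rewrite ltxx.
  congr (L _); apply/seteqP; split => x /=; rewrite !in_itv /= !andbT.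
    rewrite -lte_fin fE /gain lt_min => /andP[_].
    by rewrite lte_fin lt_max => /orP[//|]; rewrite ltNge r0.
  by move=> rx; rewrite -lte_fin fE /gain lt_min lt_max rb /= lte_fin lt_max rx.
have mb : measurable [set x : R | (x%:E < b)%E].
  have := @emeasurable_fun_infty_o _ _ _ setT EFin measurableT (@EFin_measurable R setT) b.
  by rewrite setTI.
transitivity (\int[lebesgue_measure]_(r in `[0%R, +oo[%classic `&` [set x | (x%:E < b)%E])
    (exponential_pdf 1 r)%:E)%E.
  rewrite integral_mkcondr; apply: eq_integral => r; rewrite inE /= in_itv /= andbT => r0.
  rewrite ccdfE // patchE; case: ifPn => h; first by rewrite mem_set.
  by rewrite memNset //; apply/negP.
rewrite -[LHS]/(exponential_prob 1 _) -LE; last exact: measurableI.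
have -> : L (`[0%R, +oo[%classic `&` [set x | (x%:E < b)%E]) = L [set x | (x%:E < b)%E].
  have splitE : [set x | (x%:E < b)%E] = (`[0%R, +oo[%classic `&` [set x | (x%:E < b)%E]) `|`
      (`]-oo, 0%R[%classic `&` [set x | (x%:E < b)%E]) :> set R.
    rewrite -setIUl (_ : _ `|` _ = setT) ?setTI //; apply/seteqP; split => // x _ /=.
    by rewrite !in_itv /= andbT; have [|] := leP 0 x; [left|right].
  rewrite [in RHS]splitE [RHS]measureU; [|exact: measurableI|exact: measurableI|].
    rewrite [X in (_ + X)%E](_ : _ = 0%E) ?adde0 //.
    by apply: (subset_measure0 _ _ _ exp_law_lt0) => //; exact: measurableI.
  apply/seteqP; split => // x /= [[]]; rewrite !in_itv /= andbT => x0 _ [x0' _].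
  by rewrite ltNge x0 in x0'.
(* From [<] to [<=] at most the point [b] is added, and it has no mass. *)
case: b {f fE mf fM ccdfE} mb => [r| |] mb.
- have -> : [set x : R | (x%:E <= r%:E)%E] = [set x | (x%:E < r%:E)%E] `|` [set r].
    apply/seteqP; split => x /=; rewrite !lee_fin !lte_fin le_eqVlt.
      by case/orP => [/eqP|]; [right|left].
    by case=> [->|->]; rewrite ?orbT ?eqxx.
  rewrite measureU //.
    by rewrite [X in (_ + X)%E](_ : _ = 0%E) ?adde0 //; exact: exp_law_set1.
  by apply/seteqP; split => // x /= []; rewrite lte_fin => xr xE; rewrite xE ltxx in xr.
- congr (L _); apply/seteqP; split => x /=; rewrite ?leey ?ltry //.
- congr (L _); apply/seteqP; split => x //=.
Qed.

End ExponentialGain.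

(** * Comparison of integrals of functions not known to be measurable *)

Section Unmeasurable.
Import HBNNSimple.
Context (R : realType) (d : measure_display) (S : measurableType d)
  (mu : {measure set S -> \bar R}).

(* Monotonicity needs no measurability: the integral of a nonnegative function is
   a supremum over simple functions below it, and these may be cut off on a null set. *)
Lemma ae_ge0_le_integral_unmeasurable (f g : S -> \bar R) :
  (forall x, 0 <= f x)%E -> (forall x, 0 <= g x)%E ->
  {ae mu, forall x, (f x <= g x)%E} -> (\int[mu]_x f x <= \int[mu]_x g x)%E.
Proof.
move=> f0 g0 [N [mN N0 fgN]].
rewrite !ge0_integralTE //; apply: ge_ereal_sup => _ [h hf <-].
pose h' := (h \* indic_nnsfun R (measurableC mN))%R : {nnsfun S >-> R}.
have -> : sintegral mu h = sintegral mu h'.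
  rewrite -!integralT_nnsfun; apply: ge0_ae_eq_integral => //.
  - by apply/measurable_EFinP.
  - by apply/measurable_EFinP.
  - by move=> x _; rewrite lee_fin.
  - by move=> x _; rewrite lee_fin.
  exists N; split=> // x /= /not_implyP[_ hx]; apply: contrapT => nN; apply: hx.
  by rewrite -[in LHS](mulr1 (h x)) -[1](_ : \1_(~` N) x = 1) // indicE mem_set.
apply: ereal_sup_ubound; exists h' => // x.
rewrite -[X in (X <= _)%E]/((h x * \1_(~` N) x)%:E) indicE.
have [xN|_] := boolP (x \in ~` N); last by rewrite mulr0.
rewrite mulr1; apply: le_trans (hf x) _; apply: contrapT => fg.
by move/set_mem: xN; apply; apply: fgN.
Qed.

(** The negative part of [f] only lowers its integral, and [g] bounds the positive part. This serves
    for the total weight, as the trees need not depend measurably on the sample point. *)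
Lemma ae_le_integral_ge0 (f g : S -> \bar R) :
  (forall x, 0 <= g x)%E -> {ae mu, forall x, (f x <= g x)%E} ->
  (\int[mu]_x f x <= \int[mu]_x g x)%E.
Proof.
move=> g0 fg; rewrite integralE.
apply: (@le_trans _ _ (\int[mu]_x (f ^\+ x)))%E.
  by rewrite -[leRHS]sube0; apply: leeB => //; exact: integral_ge0.
apply: ae_ge0_le_integral_unmeasurable => //.
case: fg => N [mN N0 fgN]; exists N; split=> // x h; apply: fgN => /= fgx.
by apply: h; rewrite /= funeposE ge_max fgx g0.
Qed.

(** The negative part of [f] vanishes almost everywhere, and its positive part is above [g]. *)
Lemma ae_ge0_integral_le (f g : S -> \bar R) :
  (forall x, 0 <= g x)%E -> {ae mu, forall x, (g x <= f x)%E} ->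
  (\int[mu]_x g x <= \int[mu]_x f x)%E.
Proof.
move=> g0 [N [mN N0 gfN]]; rewrite [leRHS]integralE.
have -> : (\int[mu]_x (f ^\- x) = 0)%E.
  apply/eqP; rewrite eq_le integral_ge0 // andbT -(integral0 mu setT).
  apply: ae_ge0_le_integral_unmeasurable => //.
  exists N; split=> // x h; apply: gfN => /= gfx; apply: h.
  by rewrite /= funenegE ge_max lexx andbT leeNl oppe0 (le_trans (g0 x)).
rewrite sube0; apply: ae_ge0_le_integral_unmeasurable => //.
exists N; split=> // x h; apply: gfN => /= gfx; apply: h.
by rewrite /= funeposE le_max gfx.
Qed.

Lemma ae_forall_countable (I : countType) (Q : I -> S -> Prop) :
  (forall i, {ae mu, forall x, Q i x}) -> {ae mu, forall x, forall i, Q i x}.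
Proof.
move=> H.
have : {ae mu, forall x, forall N : nat, if choice.unpickle N is Some i then Q i x else True}.
  by apply: ae_foralln => N; case: (choice.unpickle N) => [i|]; [exact: H|exact: aeW].
by apply: filterS => x h i; have := h (choice.pickle i); rewrite choice.pickleK.
Qed.

End Unmeasurable.

(** * Poisson costs *)

Section PoissonProcess.
Context (R : realType) (n : nat) (d : measure_display) (Ω : measurableType d)
  (P : probability Ω R) (X : medge n -> Ω -> R).
Hypotheses (mX : forall e, measurable_fun setT (X e))
  (lawX : forall e (B : set R), measurable B -> P (X e @^-1` B) = exponential_prob 1 B)
  (indepX : mutually_independent P X).

Let XM e : {mfun Ω >-> R} := HB.pack (X e) (isMeasurableFun.Build _ _ _ _ _ (mX e)).
Let law e : probability R R := distribution P (XM e).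
Let lawE e (B : set R) : measurable B -> law e B = exponential_prob 1 B := @lawX e B.

Lemma ae_interarrival_gt0 : {ae P, forall w, forall e, 0 < X e w}.
Proof.
apply: ae_forall_countable => e; exists (X e @^-1` `]-oo, 0]%classic); split.
- exact: (measurable_preim mX).
- rewrite -[LHS]/(law e _).
  have -> : `]-oo, 0]%classic = `]-oo, 0[%classic `|` [set 0] :> set R.
    apply/seteqP; split => x /=; rewrite !in_itv /= le_eqVlt.
      by case/orP => [/eqP|]; [right|left].
    by case=> [->|->]; rewrite ?orbT ?eqxx.
  rewrite measureU //; last first.
    by apply/seteqP; split => // x /= []; rewrite in_itv /= => x0 xE; rewrite xE ltxx in x0.
  rewrite [X in (X + _)%E](_ : _ = 0%E); last exact: (exp_law_lt0 (lawE e)).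
  by rewrite [X in (_ + X)%E](_ : _ = 0%E) ?adde0 //; exact: (exp_law_set1 (lawE e)).
by move=> w /= /negP; rewrite in_itv /= -leNgt.
Qed.

(** Given the other variables, [y] is a single value, to which the law of [X e] gives no mass. *)
Lemma ae_neq_indep e (y : others X e -> R) :
  measurable_fun setT y -> P [set w | X e w = y w] = 0%E.
Proof.
move=> my.
pose A : set (others X e * R) := [set z | z.2 = y z.1].
have mA : measurable A.
  rewrite (_ : A = [set z | z.2 <= y z.1] `&` [set z | y z.1 <= z.2]).
    have m1 : measurable_fun setT (fun z : others X e * R => z.2) by exact: measurable_snd.
    have m2 : measurable_fun setT (fun z : others X e * R => y z.1).
      by apply: measurableT_comp => //; exact: measurable_fst.
    apply: measurableI.
      have := measurable_fun_ler m1 m2.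
      by move=> /(_ measurableT [set true]); rewrite setTI; apply.
    have := measurable_fun_ler m2 m1.
    by move=> /(_ measurableT [set true]); rewrite setTI; apply.
  apply/seteqP; split => z /=; first by move=> ->.
  by case=> h1 h2; apply/eqP; rewrite eq_le h1 h2.
pose f (z : others X e * R) : \bar R := (\1_A z)%:E.
have mf : measurable_fun setT f by apply/measurable_EFinP; exact: measurable_indic.
have f0 z : (0 <= f z)%E by rewrite lee_fin.
have mE : measurable [set w : Ω | X e w = y w].
  have := measurable_fun_pair (@measurable_toothers _ _ _ _ _ mX e) (mX e).
  by move=> /(_ measurableT A mA); rewrite setTI.
have := @indep_integral _ _ _ _ _ _ mX indepX e (law e) (fun B _ => erefl) f mf f0.
rewrite /f (_ : (fun w : Ω => _) = (fun w => (\1_[set w : Ω | X e w = y w] w)%:E)); last first.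
  by apply/funext => w; rewrite !indicE; congr ((nat_of_bool _)%:R%:E); apply/idP/idP; rewrite !inE.
rewrite integral_indic // setIT => ->.
apply: integral0_eq => w _.
transitivity (law e [set y w]); last exact: (exp_law_set1 (lawE e)).
rewrite -[in RHS](setIT [set y w]) -integral_indic //; apply: eq_integral => x _.
Qed.

Lemma measurable_cum e p l : (forall j, (j < l)%N -> (p, j) != e) ->
  measurable_fun setT (fun w : others X e => cum (fun f => X f w) p l).
Proof.
elim: l => [|l IH] ne.
  rewrite (_ : (fun w : others X e => _) = cst 0) //.
  by apply/funext => w; rewrite /cum big_ord0.
rewrite (_ : (fun w : others X e => _) =
  (fun w : others X e => cum (fun f => X f w) p l + X (p, l) w)).
  apply: measurable_funD; last by apply: measurable_others; exact: ne.
  by apply: IH => j jl; apply: ne; apply: leqW.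
by apply/funext => w; rewrite cumS.
Qed.

(** The cost of [f] involves [X e] only if [f] is [e] or a later copy of it. *)
Lemma measurable_cumcost e f : (f.1 <> e.1) \/ (f.2 < e.2)%N ->
  measurable_fun setT (fun w : others X e => cumcost (fun g => X g w) f).
Proof.
move=> fe; apply: measurable_cum => j; rewrite ltnS => jf.
apply/eqP => E; case: fe => [|]; first by rewrite -E.
by rewrite -E /= ltnNge jf.
Qed.

(** Copies of one pair are strictly ordered. For distinct pairs, a tie forces the last interarrival
    time of [e] to equal a function of the other variables. *)
Lemma ae_cumcost_inj : {ae P, forall w, injective (cumcost (fun e => X e w))}.
Proof.
have ae_neq (ef : medge n * medge n) : {ae P, forall w, ef.1.1 <> ef.2.1 ->
    cumcost (fun g => X g w) ef.1 <> cumcost (fun g => X g w) ef.2}.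
  case: ef => e f /=; have [ef|ef] := pselect (e.1 = f.1); first exact: aeW.
  have my : measurable_fun setT (fun w : others X e =>
      cumcost (fun g => X g w) f - cum (fun g => X g w) e.1 e.2).
    apply: measurable_funB; first by apply: measurable_cumcost; left; exact/nesym.
    by apply: measurable_cum => j je; apply/eqP => E; rewrite -E ltnn in je.
  exists [set w | X e w = cumcost (fun g => X g w) f - cum (fun g => X g w) e.1 e.2].
  split.
  - have := measurable_funB (mX e) (measurable_from_others mX my).
    move=> /(_ measurableT [set 0] (measurable_set1 _)); rewrite setTI.
    congr (measurable _); apply/seteqP; split => w /= => [/eqP|->]; last by rewrite subrr.
    by rewrite subr_eq0 => /eqP.
  - exact: (ae_neq_indep my).
  move=> w /= /not_implyP[_ /contrapT E]; rewrite -E /cumcost cumS.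
  by rewrite -surjective_pairing addrAC subrr add0r.
have := ae_forall_countable ae_neq; have := ae_interarrival_gt0.
apply: filterS2 => w pos H e f E.
have ef1 : e.1 = f.1 by apply: contrapT => /(H (e, f)).
case: e f ef1 E {H} => p l [p' l'] /= <- E; congr pair.
by have [ll'|ll'|//] := ltngtP l l'; have := cumcost_lt pos p ll'; rewrite E ltxx.
Qed.

(** Given the other variables, [b] is constant and [exp_gain] applies. The maximum with 0 keeps the
    gain nonnegative everywhere, [X e] being positive only almost surely. *)
Lemma indep_gain e (b : others X e -> \bar R) : measurable_fun setT b ->
  (\int[P]_w gain (b w) (Num.max (X e w) 0%R) = P [set w | ((X e w)%:E <= b w)%E])%E.
Proof.
move=> mb.
have mx : measurable_fun setT (fun z : others X e * R => (z.2)%:E).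
  by apply/measurable_EFinP; exact: measurable_snd.
have mbf : measurable_fun setT (fun z : others X e * R => b z.1).
  by apply: measurableT_comp => //; exact: measurable_fst.
pose A : set (others X e * R) := [set z | (z.2%:E <= b z.1)%E].
have mA : measurable A.
  have := measurable_fun_lee mx mbf.
  by move=> /(_ measurableT [set true]); rewrite setTI; apply.
have max0 (x : R) : 0 <= Num.max x 0 by rewrite le_max lexx orbT.
pose f (z : others X e * R) : \bar R := gain (b z.1) (Num.max z.2 0).
have mf : measurable_fun setT f.
  apply: measurable_mine; first by apply: measurable_maxe => //; exact: measurable_cst.
  apply/measurable_EFinP; apply: measurable_maxr; last exact: measurable_cst.
  exact: measurable_snd.
have f0 z : (0 <= f z)%E by exact: gain_ge0.
pose g (z : others X e * R) : \bar R := (\1_A z)%:E.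
have mg : measurable_fun setT g by apply/measurable_EFinP; exact: measurable_indic.
have g0 z : (0 <= g z)%E by rewrite lee_fin.
have I h mh h0 := @indep_integral _ _ _ _ _ _ mX indepX e (law e) (fun B _ => erefl) h mh h0.
transitivity (\int[P]_w \int[law e]_x f (w : others X e, x))%E.
  by rewrite -I.
transitivity (\int[P]_w \int[law e]_x g (w : others X e, x))%E.
  apply: eq_integral => w _.
  transitivity (law e [set x : R | (x%:E <= b w)%E]).   by have := @exp_gain _ (law e) (lawE e) (b w).
  have mbw : measurable [set x : R | (x%:E <= b w)%E].
    have := @emeasurable_fun_infty_c _ _ _ setT EFin measurableT (@EFin_measurable R setT) (b w).
    by rewrite setTI.
  rewrite -[in LHS](setIT (mkset _)) -integral_indic //; apply: eq_integral => x _.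
rewrite -I // (eq_integral (fun w => (\1_[set w : Ω | ((X e w)%:E <= b w)%E] w)%:E)).
  rewrite integral_indic ?setIT //.
  have := measurable_fun_pair (@measurable_toothers _ _ _ _ _ mX e) (mX e).
  by move=> /(_ measurableT A mA); rewrite setTI.
by move=> w _; rewrite /g !indicE; congr ((nat_of_bool _)%:R%:E); apply/idP/idP; rewrite !inE.
Qed.

End PoissonProcess.

(** * An elementary integral, the number of pairs, and integrals of constants *)

Import numFieldNormedType.Exports.

Lemma integral_id_itv (R : realType) (t : R) : 0 < t ->
  (\int[lebesgue_measure]_(x in `[0%R, t]) x%:E = (t ^+ 2 / 2)%:E)%E.
Proof.
move=> t0.
have dF (x : R) : is_derive x 1 (fun y : R => y ^+ 2 / 2) x.
  by apply: is_derive_eq; rewrite /GRing.scale /=; lra.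
have cF : continuous (fun y : R => y ^+ 2 / 2).
  by move=> x; apply/differentiable_continuous/derivable1_diffP; have [] := dF x.
rewrite (@continuous_FTC2 _ id (fun y => y ^+ 2 / 2)) //.
- by rewrite expr0n /= mul0r sube0.
- by apply: continuous_subspaceT => x; exact: cvg_id.
- split.
  + by move=> x _; have [] := dF x.
  + exact/cvg_at_right_filter/cF.
  + exact/cvg_at_left_filter/cF.
- by move=> x _; rewrite derive1E; have [_ ->] := dF x.
Qed.

Lemma card_vpair (n : nat) : (2 * #|{: vpair n}| = n * n.-1)%N.
Proof.
rewrite card_sig -sum1_card.
rewrite (eq_bigl (fun p : 'I_n * 'I_n => (p.1 < p.2)%N)) //.
rewrite -(pair_big_dep xpredT (fun i j : 'I_n => (i < j)%N) (fun _ _ => 1%N)) /=.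
rewrite (exchange_big_dep xpredT) //=.
(* The vertex [j] is the larger end of [j] pairs. *)
rewrite (eq_bigr (fun j : 'I_n => j : nat)).
  rewrite -(big_mkord xpredT id) bin2_sum bin2 mul2n.
  rewrite -[RHS]odd_double_half oddM.
  by case: (n) => //= m; case: (odd m).
move=> j _; rewrite sum1_card -[RHS]card_ord.
have inj : injective (widen_ord (ltnW (ltn_ord j))).
  by move=> a b /(congr1 val) /= ab; apply: val_inj.
rewrite -(fintype.card_image inj).
apply: eq_card => i; rewrite unfold_in /=; apply/idP/fintype.imageP => [ij|[a _ ->]]; last exact: (ltn_ord a).
by exists (Ordinal ij) => //; apply: val_inj.
Qed.

Lemma expectation_const (R : realType) (d : measure_display) (Ω : measurableType d)
  (P : probability Ω R) (r : R) : (\int[P]_w r%:E = r%:E)%E.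
Proof.
rewrite (integral_cst P measurableT r%:E) [X in (_ * X)%E](_ : _ = 1%E) ?mule1 //.
exact: probability_setT.
Qed.

(** * Expected gains, counts and excesses in the Poisson model *)

Section ExpectedGain.
Context (R : realType) (n : nat) (d : measure_display) (Ω : measurableType d)
  (P : probability Ω R) (X : medge n -> Ω -> R).
Hypotheses (mX : forall e, measurable_fun setT (X e))
  (lawX : forall e (B : set R), measurable B -> P (X e @^-1` B) = exponential_prob 1 B)
  (indepX : mutually_independent P X).

Let x_ (w : Ω) : medge n -> R := fun e => X e w.

Let max0 (x : R) : 0 <= Num.max x 0.
Proof. by rewrite le_max lexx orbT. Qed.

Lemma measurable_cumcost_ambient e : measurable_fun setT (fun w => cumcost (x_ w) e).
Proof. by apply: measurable_sum => j; exact: mX. Qed.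

Lemma measurable_gain e (b : others X e -> \bar R) : measurable_fun setT b ->
  measurable_fun (setT : set Ω) (fun w : Ω => gain (b w) (Num.max (X e w) 0)).
Proof.
move=> mb; apply: measurable_mine.
  apply: measurable_maxe; last exact: measurable_cst.
  exact: (measurable_from_others mX mb).
by apply/measurable_EFinP; apply: measurable_maxr; [exact: mX|exact: measurable_cst].
Qed.

Definition pair_slack i p l (w : Ω) : \bar R :=
  slack (cumcost (x_ w)) (before p l) i p (cum (x_ w) p l).

Lemma measurable_pair_slack i p l :
  measurable_fun setT (pair_slack i p l : others X (p, l) -> \bar R).
Proof.
apply: (@measurable_slack _ _ _ _ (fun w : others X (p, l) => cumcost (x_ w)) (before p l)).
  by move=> e be; apply: measurable_cumcost; exact: be.
by apply: measurable_cum => j jl; apply/eqP => -[E]; rewrite E ltnn in jl.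
Qed.

Definition pair_gain i p l (w : Ω) : \bar R :=
  gain (pair_slack i p l w) (Num.max (X (p, l) w) 0).

Definition total_gain i (w : Ω) : \bar R := (\sum_p \sum_(l < i.+1) pair_gain i p l w)%E.

Lemma pair_gain_ge0 i p l w : (0 <= pair_gain i p l w)%E.
Proof. exact: gain_ge0. Qed.

Lemma total_gain_ge0 i w : (0 <= total_gain i w)%E.
Proof. by apply: sume_ge0 => p _; apply: sume_ge0 => l _; exact: pair_gain_ge0. Qed.

Lemma measurable_pair_gain i p l : measurable_fun setT (pair_gain i p l).
Proof. by apply: measurable_gain; exact: measurable_pair_slack. Qed.

Lemma measurable_total_gain i : measurable_fun setT (total_gain i).
Proof.
apply: emeasurable_sum => p; apply: emeasurable_sum => l.
exact: measurable_pair_gain.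
Qed.

Variable T : nat -> Ω -> {fset medge n}.
Hypothesis gT : {ae P, forall w, greedy_MSTs (cost X w) (fun i => T i w)}.

Lemma ae_regular : {ae P, forall w, [/\ forall e, 0 < X e w,
  injective (cumcost (x_ w)) & greedy_MSTs (cumcost (x_ w)) (fun i => T i w)]}.
Proof.
have h1 := ae_interarrival_gt0 mX lawX; have h2 := ae_cumcost_inj mX lawX indepX.
by move: h1 h2 gT; apply: filterS3 => w.
Qed.

(** Each expected gain is the probability of [A p l], that the edge arrives within the slack. Almost
    surely this means acceptance by the first [i.+1] trees, which have [i.+1 * n.-1] edges in
    all. *)
Lemma expected_total_gain i :
  (\int[P]_w total_gain i w <= ((i.+1 * n.-1)%:R)%:E)%E.
Proof.
pose A p l := [set w : Ω | ((X (p, l) w)%:E <= pair_slack i p l w)%E].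
have mA p l : measurable (A p l).
  have mX' : measurable_fun setT (fun w => (X (p, l) w)%:E) by apply/measurable_EFinP.
  have := measurable_fun_lee mX' (measurable_from_others mX (measurable_pair_slack i (p:=p) (l:=l))).
  by move=> /(_ measurableT [set true]); rewrite setTI; apply.
have mI p l : measurable_fun setT (fun w : Ω => (\1_(A p l) w)%:E : \bar R).
  by apply/measurable_EFinP; exact: measurable_indic.
have -> : (\int[P]_w total_gain i w =
    \int[P]_w \sum_p \sum_(l < i.+1) (\1_(A p l) w)%:E)%E.
  have sumE (h : vpair n -> nat -> Ω -> \bar R) :
      (forall p l, measurable_fun setT (h p l)) -> (forall p l w, 0 <= h p l w)%E ->
      (\int[P]_w \sum_p \sum_(l < i.+1) h p l w =
       \sum_p \sum_(l < i.+1) \int[P]_w h p l w)%E.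
    move=> mh h0; rewrite ge0_integral_sum //.
    - by apply: eq_bigr => p _; rewrite ge0_integral_sum.
    - by move=> p; apply: emeasurable_sum => l; exact: mh.
    - by move=> p w _; apply: sume_ge0.
  rewrite /total_gain sumE; last 2 first.
  - exact: measurable_pair_gain.
  - exact: pair_gain_ge0.
  rewrite (sumE (fun p l w => (\1_(A p l) w)%:E)) //.
  apply: eq_bigr => p _; apply: eq_bigr => l _; rewrite integral_indic // setIT.
  exact: (indep_gain mX lawX indepX (measurable_pair_slack i (p:=p) (l:=l))).
rewrite -[leRHS](expectation_const P).
apply: ae_ge0_le_integral_unmeasurable.
- by move=> w; apply: sume_ge0 => p _; apply: sume_ge0 => l _; rewrite lee_fin.
- by move=> w; rewrite lee_fin.
have := ae_regular; apply: filterS => w [xpos cinj gw].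
under eq_bigr do rewrite sumEFin; rewrite sumEFin lee_fin.
rewrite -(card_accepted gw cinj i.+1 (cumcost_lt xpos)).
apply: ler_sum => p _; apply: ler_sum => l _.
rewrite indicE; case: asboolP => h; last by case: (_ \in _).
rewrite memNset // => /= le; have := (rejected_slack xpos p l i).1 h.
by rewrite ltNge le.
Qed.

Lemma ae_weight_le i : {ae P, forall w,
  ((n%:R * weight (cost X w) (T i w))%:E <= 2%:E * total_gain i w)%E}.
Proof.
have := ae_regular; apply: filterS => w [xpos cinj gw].
have xmax e : Num.max (X e w) 0 = x_ w e by apply/max_l/ltW.
pose G p := \sum_(l < i.+1) fine (pair_gain i p l w).
have -> : total_gain i w = (\sum_p G p)%:E.
  rewrite /total_gain -sumEFin; apply: eq_bigr => p _.
  rewrite /G -sumEFin; apply: eq_bigr => l _.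
  by rewrite fineK // gain_fin.
rewrite -EFinM lee_fin; apply: (greedy_weight_le gw cinj).
  by move=> p; apply: sumr_ge0 => l _; rewrite fine_ge0 // pair_gain_ge0.
move=> p s /(gain_ge xpos) h; apply: le_trans h _; apply: ler_sum => l _.
by rewrite /pair_gain xmax.
Qed.

(** With [b] the time left until [t], the bound [X <= b] says that the point falls by time [t],
    while the gains telescope to at most [t]. *)
Lemma expected_count p (K : nat) (t : R) : 0 <= t ->
  (\sum_(m < K) P [set w | cumcost (x_ w) (p, nat_of_ord m) <= t]%R <= t%:E)%E.
Proof.
move=> t0.
pose b (m : nat) (w : Ω) : \bar R := (t - cum (x_ w) p m)%:E.
have mb m : measurable_fun setT (b m : others X (p, m) -> \bar R).
  apply/measurable_EFinP; apply: measurable_funB; first exact: measurable_cst.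
  by apply: measurable_cum => j jl; apply/eqP => -[E]; rewrite E ltnn in jl.
have -> : (\sum_(m < K) P [set w | cumcost (x_ w) (p, nat_of_ord m) <= t]%R =
    \int[P]_w \sum_(m < K) gain (b m w) (Num.max (X (p, nat_of_ord m) w) 0%R))%E.
  rewrite ge0_integral_sum //.
  - apply: eq_bigr => m _; rewrite (indep_gain mX lawX indepX (mb m)).
    congr (P _); apply/seteqP; split => w; rewrite /= lee_fin /cumcost cumS /= /x_; lra.
  - by move=> m; exact: measurable_gain.
  - by move=> m w _; exact: gain_ge0.
rewrite -[leRHS](expectation_const P).
apply: ae_ge0_le_integral_unmeasurable.
- by move=> w; apply: sume_ge0 => m _; exact: gain_ge0.
- by move=> w; rewrite lee_fin.
have := ae_interarrival_gt0 mX lawX; apply: filterS => w xpos.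
have gE (m : nat) : gain (b m w) (Num.max (X (p, m) w) 0) =
    (Num.min t (cum (x_ w) p m.+1) - Num.min t (cum (x_ w) p m))%:E.
  rewrite max_l ?ltW // /gain /b -EFin_max -EFin_min cumS /x_; congr EFin.
  have := xpos (p, m); set c := cum _ p m; set x := X _ w => x0.
  have [h1|h1] := leP (t - c) 0; have [h2|h2] := leP t (c + x);
  have [h3|h3] := leP t c; rewrite ?(min_l (ltW x0)); try lra.
  - by rewrite min_l; lra.
  - by rewrite min_r; lra.
under eq_bigr do rewrite gE.
rewrite sumEFin lee_fin.
rewrite -(big_mkord xpredT (fun m => Num.min t (cum (x_ w) p m.+1) - Num.min t (cum (x_ w) p m))).
rewrite (telescope_sumr (fun m => Num.min t (cum (x_ w) p m))) //.
rewrite /cum big_ord0 (min_r t0) subr0.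
by rewrite ge_min lexx.
Qed.

(** The excess over a cost [c] is the length of the set of levels [s] in [[c, t]]. After exchanging
    integrals, the expected count at level [s] is at most [s], and [s] is integrated over
    [[0, t]]. *)
Lemma expected_excess p (K : nat) (t : R) : 0 < t ->
  (\int[P]_w \sum_(m < K) (Num.max (t - cumcost (x_ w) (p, nat_of_ord m)) 0%R)%:E <=
   (t ^+ 2 / 2)%:E)%E.
Proof.
move=> t0.
pose A (m : nat) : set (Ω * measurableTypeR R) :=
  [set z | cumcost (x_ z.1) (p, m) <= z.2] `&` [set z | `[0, t]%classic z.2].
have mA m : measurable (A m).
  have m1 : measurable_fun setT (fun z : Ω * measurableTypeR R => cumcost (x_ z.1) (p, m)).
    apply: (@measurableT_comp _ _ _ _ _ _ (fun w => cumcost (x_ w) (p, m))).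
      exact: measurable_cumcost_ambient.
    exact: measurable_fst.
  have m2 : measurable_fun setT (fun z : Ω * measurableTypeR R => z.2 : R).
    exact: measurable_snd.
  apply: measurableI.
    have := measurable_fun_ler m1 m2.
    by move=> /(_ measurableT [set true]); rewrite setTI; apply.
  by have := m2 measurableT `[0, t]%classic; rewrite setTI; apply; exact: measurable_itv.
pose h (z : Ω * measurableTypeR R) : \bar R := (\sum_(m < K) (\1_(A m) z)%:E)%E.
have mh : measurable_fun setT h.
  by apply: emeasurable_sum => m; apply/measurable_EFinP; exact: measurable_indic.
have h0 z : (0 <= h z)%E by apply: sume_ge0 => m _; rewrite lee_fin.
pose leb : {sigma_finite_measure set (measurableTypeR R) -> \bar R} := lebesgue_measure.
apply: (@le_trans _ _ (\int[P]_w \int[leb]_s h (w, s))%E).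
  apply: ae_ge0_le_integral_unmeasurable.
  - by move=> w; apply: sume_ge0 => m _; rewrite lee_fin.
  - by move=> w; apply: integral_ge0 => s _.
  have := ae_interarrival_gt0 mX lawX; apply: filterS => w xpos.
  have mAw (m : nat) : measurable_fun setT (fun s : measurableTypeR R => (\1_(A m) (w, s))%:E : \bar R).
    apply/measurable_EFinP.
    apply: (@measurableT_comp _ _ _ _ _ _ (\1_(A m) : Ω * measurableTypeR R -> R)).
      exact: measurable_indic.
    exact: measurable_pair1.
  rewrite /h ge0_integral_sum //.
  apply: lee_sum => m _.
  set c := cumcost (x_ w) (p, nat_of_ord m).
  have c0 : 0 <= c.
    by rewrite /c /cumcost /cum; apply: sumr_ge0 => j _; exact/ltW/xpos.
  rewrite (_ : (fun s => _) = (fun s => (\1_(`[c, t]%classic : set R) s)%:E)); last first.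
    apply/funext => s; rewrite !indicE; congr ((nat_of_bool _)%:R%:E).
    apply/idP/idP; rewrite !inE /A /= !in_itv /=.
      by case=> cs /andP[_ ->]; rewrite andbT.
    by case/andP=> cs ->; split=> //; rewrite andbT; exact: le_trans cs.
  rewrite integral_indic // setIT [leRHS](lebesgue_measure_itv `[c, t]) /= lte_fin.
  by case: ltP => ct; rewrite ?EFinB // lee_fin ge_max lexx ?andbT; lra.
rewrite (@fubini_tonelli _ _ _ _ _ P leb h) //.
rewrite -integral_id_itv // [leRHS]integral_mkcond.
apply: ge0_le_integral => //.
- by move=> s _; apply: integral_ge0.
- by have := @measurable_fun_fubini_tonelli_G _ _ _ _ _ P h mh h0.
- apply/(measurable_restrictT _ _).1; first exact: measurable_itv.
  by apply/measurable_EFinP; exact: measurable_id.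
move=> s _; rewrite patchE /h.
have mAs (m : nat) : measurable_fun setT (fun w : Ω => (\1_(A m) (w, s))%:E : \bar R).
  apply/measurable_EFinP.
  apply: (@measurableT_comp _ _ _ _ _ _ (\1_(A m) : Ω * measurableTypeR R -> R)).
    exact: measurable_indic.
  exact: measurable_pair2.
case: ifPn => [/set_mem /= |] st; last first.
  rewrite integral0_eq // => w _; rewrite big1 // => m _.
  by rewrite indicE memNset // => -[_ /= H]; move/negP: st; apply; rewrite inE.
have s0 : 0 <= s by move: st; rewrite in_itv /= => /andP[].
rewrite ge0_integral_sum //.
apply: le_trans (expected_count p K s0).
apply: lee_sum => m _.
rewrite (_ : (fun w => _) = (fun w => (\1_[set w | (cumcost (x_ w) (p, nat_of_ord m) <= s)%R] w)%:E)); last first.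
  apply/funext => w; rewrite !indicE; congr ((nat_of_bool _)%:R%:E).
  apply/idP/idP; rewrite !inE /A /=; first by case.
  by move=> h'; split.
rewrite integral_indic ?setIT //.
have := measurable_fun_ler (measurable_cumcost_ambient (p, nat_of_ord m)) (measurable_cst s).
by move=> /(_ measurableT [set true]); rewrite setTI; apply.
Qed.

End ExpectedGain.

Theorem theorem3p1 (R : realType) (n : nat) (d : measure_display)
    (Ω : measurableType d) (P : probability Ω R)
    (X : medge n -> Ω -> R) (T : nat -> Ω -> {fset medge n}) :
  (1 < n)%N ->
  (forall e, measurable_fun setT (X e)) ->
  (forall e (B : set R), measurable B -> P (X e @^-1` B) = exponential_prob 1 B) ->
  mutually_independent P X ->
  {ae P, forall w, greedy_MSTs (cost X w) (fun i => T i w)} ->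
  forall k : nat, (0 < k)%N ->
  let W := fun w => \sum_(i < k) weight (cost X w) (T i w) in
  let q := (n.-1)%:R / n%:R : R in
  (((k ^ 2)%:R * q)%:E <= \int[P]_w (W w)%:E)%E /\
  (\int[P]_w (W w)%:E <= ((k * k.+1)%:R * q)%:E)%E /\
  (k * k.+1)%:R * q < (k ^ 2 + k)%:R.
Proof.
move=> n1 mX lawX indepX gT k k0 W q.
have n0 : 0 < n%:R :> R by rewrite ltr0n (ltn_trans _ n1).
have nE : n%:R = (n.-1)%:R + 1 :> R by rewrite natr1 prednK // (ltn_trans _ n1).
have k0' : 0 < k%:R :> R by rewrite ltr0n.
have mcost e := measurable_cumcost_ambient mX e.
have reg := ae_regular mX lawX indepX gT.
split; [|split].
(* This [t] maximizes [k (n - 1) t - n (n - 1) t^2 / 4]. *)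
- pose t : R := 2 * k%:R / n%:R.
  have t0 : 0 < t by rewrite divr_gt0 // mulr_gt0.
  pose Y w := \sum_p \sum_(m < k) Num.max (t - cumcost (X^~ w) (p, nat_of_ord m)) 0.
  have mY : measurable_fun setT Y.
    apply: measurable_sum => p; apply: measurable_sum => m.
    apply: measurable_maxr; last exact: measurable_cst.
    by apply: measurable_funB; [exact: measurable_cst|exact: mcost].
  have Y0 w : 0 <= Y w.
    by apply: sumr_ge0 => p _; apply: sumr_ge0 => m _; rewrite le_max lexx orbT.
  have EY : (\int[P]_w (Y w)%:E <= ((k ^ 2)%:R * q)%:E)%E.
    have -> : (\int[P]_w (Y w)%:E = \sum_p \int[P]_w \sum_(m < k)
        (Num.max (t - cumcost (X^~ w) (p, nat_of_ord m)) 0%R)%:E)%E.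
      rewrite -ge0_integral_sum //.
      + by apply: eq_integral => w _; rewrite -sumEFin; apply: eq_bigr => p _; rewrite sumEFin.
      + move=> p; apply: emeasurable_sum => m; apply/measurable_EFinP.
        apply: measurable_maxr; last exact: measurable_cst.
        by apply: measurable_funB; [exact: measurable_cst|exact: mcost].
      + by move=> p w _; apply: sume_ge0 => m _; rewrite lee_fin le_max lexx orbT.
    apply: (@le_trans _ _ (\sum_(p : vpair n) (t ^+ 2 / 2)%:E)%E).
      by apply: lee_sum => p _; exact: (expected_excess mX lawX indepX).
    rewrite sumEFin lee_fin.
    have -> : \sum_(p : vpair n) (t ^+ 2 / 2) = #|{: vpair n}|%:R * (t ^+ 2 / 2).
      by rewrite sumr_const mulr_natl.
    have := congr1 (fun m => m%:R : R) (card_vpair n); rewrite !natrM => cv.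
    have cE : #|{: vpair n}|%:R = n%:R * (n.-1)%:R / 2 :> R by lra.
    rewrite cE /t /q le_eqVlt; apply/orP; left; apply/eqP.
    by field; rewrite gt_eqF.
  (* Cutting off at 0 gives a nonnegative measurable function that is almost surely at most [W]. *)
  pose g w : R := Num.max ((k * n.-1)%:R * t - Y w) 0.
  have g0 w : 0 <= g w by rewrite le_max lexx orbT.
  have mg : measurable_fun setT g.
    apply: measurable_maxr; last exact: measurable_cst.
    by apply: measurable_funB; [exact: measurable_cst|].
  have gW : (\int[P]_w (g w)%:E <= \int[P]_w (W w)%:E)%E.
    apply: ae_ge0_integral_le; first by move=> w; rewrite lee_fin.
    move: reg; apply: filterS => w [xpos cinj gw].
    rewrite lee_fin ge_max; apply/andP; split.
      exact: (sum_weight_ge gw cinj k t (cumcost_lt xpos)).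
    apply: sumr_ge0 => i _; apply: sumr_ge0 => e _.
    by apply: sumr_ge0 => l _; exact/ltW/xpos.
  apply: le_trans gW.
  (* Additivity is applied to the nonnegative [g] and [Y], which avoids subtracting integrals. *)
  have le : (((k * n.-1)%:R * t)%:E <= \int[P]_w (g w)%:E + \int[P]_w (Y w)%:E)%E.
    rewrite -ge0_integralD //; last 4 first.
    + by move=> w _; rewrite lee_fin.
    + exact/measurable_EFinP.
    + by move=> w _; rewrite lee_fin.
    + exact/measurable_EFinP.
    rewrite -(expectation_const P); apply: ae_ge0_le_integral_unmeasurable.
    + by move=> w; rewrite lee_fin mulr_ge0 // ltW.
    + by move=> w; rewrite -EFinD lee_fin addr_ge0.
    apply: aeW => w; rewrite -EFinD lee_fin -lerBlDr.
    by rewrite /g le_max lexx.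
  (* The constant is twice the desired bound, and [Y] takes away at most half of it. *)
  have tE : (k * n.-1)%:R * t = (k ^ 2)%:R * q + (k ^ 2)%:R * q.
    by rewrite /t /q natrM natrX; field; rewrite gt_eqF.
  rewrite tE EFinD in le.
  rewrite -(leeD2rE _ _ (x := ((k ^ 2)%:R * q)%:E)) //.
  by apply: le_trans le _; apply: leeD2l.
(* A measurable function almost surely above [W], by [ae_weight_le] divided by [n]. *)
- pose G w := (\sum_(i < k) (2 / n%:R)%:E * total_gain X i w)%E.
  have c0 : 0 <= 2 / n%:R :> R by rewrite divr_ge0.
  apply: (@le_trans _ _ (\int[P]_w G w)%E).
    apply: ae_le_integral_ge0.
      by move=> w; apply: sume_ge0 => i _; rewrite mule_ge0 ?lee_fin // total_gain_ge0.
    have : {ae P, forall w, forall i : nat, ((n%:R * weight (cost X w) (T i w))%:E <=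
        2%:E * total_gain X i w)%E}.
      apply: ae_foralln => i; exact: (ae_weight_le mX lawX indepX gT i).
    apply: filterS => w H; rewrite /W -sumEFin; apply: lee_sum => i _.
    have -> : ((2 / n%:R)%:E * total_gain X i w = n%:R^-1%:E * (2%:E * total_gain X i w))%E.
      by rewrite muleA -EFinM [(n%:R^-1 * 2)%R]mulrC.
    by rewrite lee_pdivlMl // -EFinM; exact: H.
  rewrite /G ge0_integral_sum //; last 2 first.
  + by move=> i; apply: measurable_funeM; exact: measurable_total_gain.
  + by move=> i w _; rewrite mule_ge0 ?lee_fin // total_gain_ge0.
  apply: (@le_trans _ _ (\sum_(i < k) (2 / n%:R * (i.+1 * n.-1)%:R)%:E)%E).
    apply: lee_sum => i _; rewrite ge0_integralZl //.
    * rewrite [leRHS]EFinM; apply: lee_wpmul2l; first by rewrite lee_fin.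
      exact: (expected_total_gain mX lawX indepX gT).
    * exact: measurable_total_gain.
    * by move=> w _; exact: total_gain_ge0.
  rewrite sumEFin lee_fin -mulr_sumr.
  (* The triangular sum brings a half that cancels the 2 of [2 / n]. *)
  have -> : \sum_(i < k) (i.+1 * n.-1)%:R = (k * k.+1)%:R * (n.-1)%:R / 2 :> R.
    elim: (k) => [|m IH]; first by rewrite big_ord0 mul0n !mul0r.
    by rewrite big_ord_recr /= IH !natrM -[m.+2%:R]natr1 -[m.+1%:R]natr1; field.
  by rewrite /q le_eqVlt; apply/orP; left; apply/eqP; field; rewrite gt_eqF.
- have -> : (k ^ 2 + k = k * k.+1)%N by rewrite mulnS addnC expnS expn1.
  rewrite -[ltRHS]mulr1 ltr_pM2l ?ltr0n ?muln_gt0 ?k0 //.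
  by rewrite /q ltr_pdivrMr // mul1r nE ltrDl.
Qed.
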